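(* Let $\mathcal{H}$ be a real Hilbert space, $z\in\mathcal{H}$, $A:\mathcal{H}\rightrightarrows\mathcal{H}$ a maximally monotone operator and $C:\mathcal{H}\rightarrow\mathcal{H}$ a monotone and $\mu$-Lipschitzian operator for $\mu>0$. Let $m$ be a strictly positive integer and, for each $i\in\{1,\dots,m\}$, let $\mathcal{G}_i$ be a real Hilbert space, $r_i\in\mathcal{G}_i$, $B_i:\mathcal{G}_i\rightrightarrows\mathcal{G}_i$ a maximally monotone operator, $D_i:\mathcal{G}_i\rightrightarrows\mathcal{G}_i$ a monotone operator such that $D_i^{-1}$ is (a single-valued operator $\mathcal{G}_i\to\mathcal{G}_i$ which is) $\nu_i$-Lipschitzian for $\nu_i>0$, and $L_i:\mathcal{H}\rightarrow\mathcal{G}_i$ a nonzero linear continuous operator. Suppose that $$z\in\operatorname{ran}\left(A+\sum_{i=1}^mL_i^*\big((B_i\Box D_i)(L_i\cdot-r_i)\big)+C\right).$$ Set $$\beta=\max\{\mu,\nu_1,\dots,\nu_m\}+\sqrt{\sum_{i=1}^m\|L_i\|^2}.$$ Let $\lambda,\sigma>0$ and $\alpha_1,\alpha_2\geq 0$ be such that $$12\alpha_2^2+9(\alpha_1+\alpha_2)+4\sigma<1,$$ let $(\lambda_n)_{n\geq 1}$ be a sequence of real numbers such that $$\lambda\leq\lambda_n\leq\frac{1}{\beta}\sqrt{\frac{1-12\alpha_2^2-9(\alpha_1+\alpha_2)-4\sigma}{12\alpha_2^2+8(\alpha_1+\alpha_2)+4\sigma+2}}\quad\text{for all } n\geq 1,$$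 and, for $j=1,2$, let $(\alpha_{j,n})_{n\geq 1}$ be a nondecreasing sequence with $\alpha_{j,1}=0$ and $0\leq\alpha_{j,n}\leq\alpha_j$ for all $n\geq 1$. Let $x_0,x_1\in\mathcal{H}$ and $v_{i,0},v_{i,1}\in\mathcal{G}_i$, $i=1,\dots,m$, be arbitrary and define, for all $n\geq 1$, $$\begin{aligned} p_{1,n}&=J_{\lambda_nA}\Big[x_n-\lambda_n\Big(Cx_n+\sum_{i=1}^mL_i^*v_{i,n}-z\Big)+\alpha_{1,n}(x_n-x_{n-1})\Big],\\ p_{2,i,n}&=J_{\lambda_nB_i^{-1}}\big[v_{i,n}+\lambda_n(L_ix_n-D_i^{-1}v_{i,n}-r_i)+\alpha_{1,n}(v_{i,n}-v_{i,n-1})\big],\quad i=1,\dots,m,\\ v_{i,n+1}&=\lambda_nL_i(p_{1,n}-x_n)+\lambda_n(D_i^{-1}v_{i,n}-D_i^{-1}p_{2,i,n})+p_{2,i,n}+\alpha_{2,n}(v_{i,n}-v_{i,n-1}),\quad i=1,\dots,m,\\ x_{n+1}&=\lambda_n\sum_{i=1}^mL_i^*(v_{i,n}-p_{2,i,n})+\lambda_n(Cx_n-Cp_{1,n})+p_{1,n}+\alpha_{2,n}(x_n-x_{n-1}). \end{aligned}$$ Then the following statements are true: (a) $\sum_{n\in\mathbb{N}}\|x_{n+1}-x_n\|^2<+\infty$, $\sum_{n\geq 1}\|x_n-p_{1,n}\|^2<+\infty$ and, for $i=1,\dots,m$, $\sum_{n\in\mathbb{N}}\|v_{i,n+1}-v_{i,n}\|^2<+\infty$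 and $\sum_{n\geq 1}\|v_{i,n}-p_{2,i,n}\|^2<+\infty$; (b) there exists $(\overline{x},\overline{v}_1,\dots,\overline{v}_m)\in\mathcal{H}\times\mathcal{G}_1\times\dots\times\mathcal{G}_m$ which is a primal-dual solution, i.e. $$z-\sum_{i=1}^mL_i^*\overline{v}_i\in A\overline{x}+C\overline{x}\quad\text{and}\quad\overline{v}_i\in(B_i\Box D_i)(L_i\overline{x}-r_i),\ i=1,\dots,m,$$ such that the following hold: (i) $x_n\rightharpoonup\overline{x}$, $p_{1,n}\rightharpoonup\overline{x}$ and, for $i=1,\dots,m$, $v_{i,n}\rightharpoonup\overline{v}_i$ and $p_{2,i,n}\rightharpoonup\overline{v}_i$ (weakly) as $n\rightarrow+\infty$; (ii) if $A+C$ is uniformly monotone at $\overline{x}$, then $x_n\rightarrow\overline{x}$ and $p_{1,n}\rightarrow\overline{x}$ (strongly) as $n\rightarrow+\infty$; (iii) if $B_i^{-1}+D_i^{-1}$ is uniformly monotone at $\overline{v}_i$ for some $i\in\{1,\dots,m\}$, then $v_{i,n}\rightarrow\overline{v}_i$ and $p_{2,i,n}\rightarrow\overline{v}_i$ (strongly) as $n\rightarrow+\infty$.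
   Context: $\mathbb{N}=\{0,1,2,\dots\}$. The symbols $\rightharpoonup$ and $\rightarrow$ denote weak and strong convergence. For a set-valued operator $T:\mathcal{H}\rightrightarrows\mathcal{H}$ on a real Hilbert space: $\operatorname{Gr}T=\{(x,u):u\in Tx\}$ is its graph, $\operatorname{dom}T=\{x:Tx\neq\emptyset\}$ its domain, $\operatorname{ran}T=\bigcup_{x\in\mathcal{H}}Tx$ its range, and $T^{-1}$ its inverse, defined by $(u,x)\in\operatorname{Gr}T^{-1}$ iff $(x,u)\in\operatorname{Gr}T$. $T$ is monotone if $\langle x-y,u-v\rangle\geq 0$ for all $(x,u),(y,v)\in\operatorname{Gr}T$, and maximally monotone if it is monotone and its graph has no proper monotone extension. The resolvent of $T$ is $J_T=(\operatorname{Id}+T)^{-1}$, single-valued and everywhere defined when $T$ is maximally monotone. A single-valued operator $T$ is $\gamma$-Lipschitzian if $\|Tx-Ty\|\leq\gamma\|x-y\|$ for all $x,y$. The parallel sum of two set-valued operators is $S\Box T=(S^{-1}+T^{-1})^{-1}$. $L_i^*$ is the adjoint of $L_i$ and $\|L_i\|$ its operator norm. The operator $L_i^*\big((B_i\Box D_i)(L_i\cdot-r_i)\big)$ is the set-valued operator $x\mapsto L_i^*\big((B_i\Box D_i)(L_ix-r_i)\big)$ on $\mathcal{H}$. $T$ is uniformly monotone at $x\in\operatorname{dom}T$ if there exists an increasing function $\phi_T:[0,+\infty)\rightarrow[0,+\infty]$ that vanishes only at $0$ such that $\langle x-y,u-v\rangle\geq\phi_T(\|x-y\|)$ for every $u\in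 Tx$ and every $(y,v)\in\operatorname{Gr}T$. *)

(* Defs.v *)
(* Library: MathComp and MathComp-Analysis, over an arbitrary R : realType. *)
From HB Require Import structures.
From mathcomp Require Import all_boot all_order all_algebra.
From mathcomp Require Import all_classical all_reals all_analysis.

Set Implicit Arguments.
Unset Strict Implicit.
Unset Printing Implicit Defensive.

Import Order.TTheory GRing.Theory Num.Theory.
Import numFieldNormedType.Exports.

Local Open Scope classical_set_scope.
Local Open Scope ring_scope.

(* A real Hilbert space: a complete normed R-module whose norm is induced by an
   inner product ({dot H for idfun}: positive definite symmetric bilinear). *)
HB.mixin Record NormedModule_isHilbert (R : realType) H
    & NormedModule R H := {
  inner : {dot H for idfun} ;
  inner_norm : forall x : H, inner x x = `|x| ^+ 2
}.

#[short(type="hilbertType")]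
HB.structure Definition Hilbert (R : realType) :=
  {H of CompleteNormedModule R H & NormedModule_isHilbert R H}.

Notation "'<[ x , y ]>" := (inner x y)
  (at level 0, x at level 99, y at level 99, format "''<[' x ,  y ]>")
  : ring_scope.

Definition weakly_cvg (R : realType) (H : hilbertType R) (u : nat -> H)
  (x : H) : Prop :=
  forall y : H, '<[u n, y]> @[n --> \oo] --> '<[x, y]>.

(* A set-valued operator from H to G is a map T : H -> set G, so that
   u \in T x is written [T x u]. *)
Section SetValued.
Context {R : realType} {H G : hilbertType R}.

Definition gr (T : H -> set G) : set (H * G) := [set xu | T xu.1 xu.2].

Definition dom (T : H -> set G) : set H := [set x | T x !=set0].

Definition ran (T : H -> set G) : set G := \bigcup_(x in [set: H]) T x.

Definition inv_op (T : H -> set G) : G -> set H := fun u => [set x | T x u].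

Definition fun_op (f : H -> G) : H -> set G := fun x => [set f x].

Definition single_valued (T : H -> set G) : Prop :=
  forall x, exists u, T x = [set u].

(* The function underlying a single-valued operator; off single-valued
   operators the value is an arbitrary element of T x (or the default point). *)
Definition op_fun (T : H -> set G) : H -> G := fun x => get (T x).

Definition add_op (S T : H -> set G) : H -> set G :=
  fun x => [set u + w | u in S x & w in T x].

Definition sum_op (I : finType) (T : I -> H -> set G) : H -> set G :=
  fun x => [set \sum_i u i | u in [set u : I -> G | forall i, T i x (u i)]].

Definition scale_op (a : R) (T : H -> set G) : H -> set G :=
  fun x => [set a *: u | u in T x].

End SetValued.

Definition psum_op (R : realType) (H : hilbertType R) (S T : H -> set H) :
  H -> set H := inv_op (add_op (inv_op S) (inv_op T)).

Definition resolvent (R : realType) (H : hilbertType R) (T : H -> set H) :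
  H -> set H := inv_op (add_op (fun_op id) T).

Section Monotone.
Context {R : realType} {H : hilbertType R}.

Definition monotone_op (T : H -> set H) : Prop :=
  forall x u y w, gr T (x, u) -> gr T (y, w) -> 0 <= '<[x - y, u - w]>.

Definition maximally_monotone (T : H -> set H) : Prop :=
  monotone_op T /\
  forall S : H -> set H, monotone_op S -> gr T `<=` gr S -> gr S = gr T.

(* As usual for a modulus with values in [0, +oo], "increasing" is understood
   in the wide sense.  Only the values of phi on [0, +oo[ matter. *)
Definition uniformly_monotone_at (T : H -> set H) (x : H) : Prop :=
  dom T x /\
  exists phi : R -> \bar R,
    [/\ (forall t, 0 <= t -> (0 <= phi t)%E),
        (forall s t, 0 <= s -> s <= t -> (phi s <= phi t)%E),
        (forall t, 0 <= t -> (phi t = 0%E <-> t = 0)) &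
        forall u y w, T x u -> gr T (y, w) ->
          (phi `|x - y|%R <= ('<[x - y, u - w]>%R)%:E)%E].

End Monotone.

Section Linear.
Context {R : realType} {H G : hilbertType R}.

Definition opnorm (L : H -> G) : R :=
  sup [set `|L x| | x in [set x : H | `|x| <= 1]].

(* The vector adjoint L y exists and is unique by the Riesz representation
   theorem when L is linear and continuous; [get] selects it. *)
Definition adjoint (L : H -> G) : G -> H :=
  fun y => get [set w : H | forall x : H, '<[L x, y]> = '<[x, w]>].

End Linear.

(* Main.v *)
(* On the product of H and the G_i the algorithm is an inertial Tseng
   (forward-backward-forward) iteration for the inclusion 0 in M w + Q w, where
   M = (A - z) x (r_i + B_i^-1) is block diagonal and maximally monotone and
   Q(x, v) = (C x + sum_i L_i^* v_i, D_i^-1 v_i - L_i x) is monotone and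
   beta-Lipschitz: the single-valued operators plus a skew coupling.
   For a zero w, phi_n = |X_n - w|^2 and delta_n = |X_(n+1) - X_n|^2 satisfy
   phi_(n+2) - phi_(n+1) - a_n (phi_(n+1) - phi_n)
     <= gamma delta_n - (gamma + sigma) delta_(n+1),
   whence sum delta_n < oo and phi_n converges.  The resolvents are total by
   Minty's theorem, obtained here by minimizing the Fitzpatrick function plus half
   the squared norm; weak limits are taken along ultrafilters, which dispenses with
   subsequences, and Opial's argument shows that they all agree. *)
Require Import Defs.
From HB Require Import structures.
From mathcomp Require Import all_boot all_order all_algebra.
From mathcomp Require Import all_classical all_reals all_analysis.
From mathcomp Require Import ring lra.

Set Implicit Arguments.
Unset Strict Implicit.
Unset Printing Implicit Defensive.

Import Order.TTheory GRing.Theory Num.Theory.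
Import numFieldNormedType.Exports.

Local Open Scope classical_set_scope.
Local Open Scope ring_scope.

(** * Inner products and minimization *)

Section InnerProduct.
Context {R : realType} {H : hilbertType R}.
Implicit Types (x y z : H) (a : R).

Lemma ipC x y : '<[x, y]> = '<[y, x]>.
Proof. by rewrite hermC expr0 mul1r. Qed.

Lemma ipDl x y z : '<[x + y, z]> = '<[x, z]> + '<[y, z]>.
Proof. exact: linearDl. Qed.

Lemma ipDr x y z : '<[z, x + y]> = '<[z, x]> + '<[z, y]>.
Proof. exact: linearDr. Qed.

Lemma ipNl x z : '<[- x, z]> = - '<[x, z]>.
Proof. exact: linearNl. Qed.

Lemma ipNr x z : '<[z, - x]> = - '<[z, x]>.
Proof. exact: linearNr. Qed.

Lemma ipZl a x z : '<[a *: x, z]> = a * '<[x, z]>.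
Proof. exact: linearZl_LR. Qed.

Lemma ipZr a x z : '<[z, a *: x]> = a * '<[z, x]>.
Proof. exact: linearZr_LR. Qed.

Definition ipE := (ipDl, ipDr, ipNl, ipNr, ipZl, ipZr).

Lemma ip_ge0 x : 0 <= '<[x, x]>.
Proof. by rewrite inner_norm sqr_ge0. Qed.

Lemma ip0l x : '<[0, x]> = 0.
Proof. by rewrite -(scale0r 0) ipZl mul0r. Qed.

Lemma ip0r x : '<[x, 0]> = 0.
Proof. by rewrite ipC ip0l. Qed.

Lemma ip_eq0 x : '<[x, x]> = 0 -> x = 0.
Proof. by rewrite inner_norm => /eqP; rewrite sqrf_eq0 normr_eq0 => /eqP. Qed.

Lemma ip_suml (I : finType) (F : I -> H) y :
  '<[\sum_i F i, y]> = \sum_i '<[F i, y]>.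
Proof. by apply: (big_morph (fun u => '<[u, y]>)) => [u w|]; [exact: ipDl|exact: ip0l]. Qed.

Lemma ip_inj x y : (forall z, '<[x, z]> = '<[y, z]>) -> x = y.
Proof.
move=> xy; apply/eqP; rewrite -subr_eq0; apply/eqP/ip_eq0.
by rewrite ipDl ipNl xy subrr.
Qed.

Lemma ip_polarization x y :
  '<[x, y]> = 4^-1 * (`|x + y| ^+ 2 - `|x - y| ^+ 2).
Proof. by rewrite -!inner_norm !ipE (ipC y x); field. Qed.

Lemma cauchy_schwarz x y : `|'<[x, y]>| <= `|x| * `|y|.
Proof.
have [->|y0] := eqVneq y 0; first by rewrite ip0r normr0 mulr_ge0.
rewrite -ler_sqr ?nnegrE ?mulr_ge0 // exprMn real_normK ?num_real //.
have y2 : 0 < `|y| ^+ 2 by rewrite exprn_gt0 // normr_gt0.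
rewrite -(ler_pM2r y2) -!inner_norm -subr_ge0.
have := ip_ge0 ('<[y, y]> *: x - '<[x, y]> *: y).
by rewrite !ipE (ipC y x); congr (_ <= _); ring.
Qed.

Lemma young_ip a x y : 0 < a -> 2 * '<[x, y]> <= a * '<[x, x]> + a^-1 * '<[y, y]>.
Proof.
move=> a0; have := ip_ge0 (a *: x - y); rewrite !ipE (ipC y x) => h.
rewrite -(ler_pM2l a0) -subr_ge0.
by apply: (le_trans h); rewrite le_eqVlt; apply/orP; left; apply/eqP; field; exact: lt0r_neq0.
Qed.

(** Polarization reduces joint continuity of the inner product to continuity of the norm, along any
    filter. *)
Lemma cvg_ip T (F : set_system T) {FF : Filter F} (u w : T -> H) x y :
  u @ F --> x -> w @ F --> y -> '<[u t, w t]> @[t --> F] --> '<[x, y]>.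
Proof.
move=> ux wy; rewrite ip_polarization.
under eq_fun do rewrite ip_polarization !expr2.
rewrite !expr2; apply: cvgMr; apply: cvgB; apply: cvgM; apply: cvg_norm.
all: by [exact: cvgD|exact: cvgB].
Qed.

Lemma cvg_of_ip_dist0 T (F : set_system T) {FF : Filter F} (u : T -> H) x :
  '<[u t - x, u t - x]> @[t --> F] --> 0 -> u @ F --> x.
Proof.
move=> h; apply/cvgrPdist_lt => e e0.
have e2 : 0 < e ^+ 2 by rewrite exprn_gt0.
have /cvgrPdist_lt/(_ _ e2) := h; apply: filterS => t.
rewrite sub0r normrN ger0_norm ?ip_ge0 // inner_norm distrC.
by rewrite ltr_pXn2r // nnegrE // ltW.
Qed.

(** A Cauchy criterion in the shape that minimizing sequences deliver: the bound is a sum of the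
    separate errors of the two terms. *)
Lemma cvg_of_sqr_dist (X : nat -> H) (h : nat -> R) :
  h @ \oo --> 0 -> (forall n k, `|X n - X k| ^+ 2 <= h n + h k) ->
  cvg (X @ \oo).
Proof.
move=> h0 hX; apply: cauchy_cvg; apply/cauchyP => e e0.
have e2 : 0 < e ^+ 2 / 2 by rewrite divr_gt0 // exprn_gt0.
have hs : \forall n \near \oo, h n < e ^+ 2 / 2 by exact: (cvgr_lt 0 h0).
have [N _ hN] := hs.
exists (X N), N => // n /= Nn; rewrite -ball_normE /ball_ /=.
rewrite -(@ltr_pXn2r _ 2) ?nnegrE //; last exact: ltW.
by apply: (le_lt_trans (hX _ _)); rewrite (splitr (e ^+ 2)) ltrD ?hN //=.
Qed.

End InnerProduct.

(** Extracts a first-order condition from minimality along a segment: [D] is the first-order term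
    and [t * K] the remainder after division by [t]. *)
Lemma ge0_of_affine (R : realFieldType) (D K : R) :
  0 <= K -> (forall t, 0 < t -> t <= 1 -> 0 <= D + t * K) -> 0 <= D.
Proof.
move=> K0 h; rewrite leNgt; apply/negP => D0.
have KD : 0 < K - D by rewrite subr_gt0 (lt_le_trans D0).
(* For negative [D] this value of [t] lies in []0, 1]] because [0 <= K], and it turns [D + t * K]
   into [- (D ^+ 2 / (K - D))], which is negative. *)
have t0 : 0 < - D / (K - D) by rewrite divr_gt0 // oppr_gt0.
have t1 : - D / (K - D) <= 1 by rewrite ler_pdivrMr // mul1r; lra.
have := h _ t0 t1.
have -> : D + - D / (K - D) * K = - (D ^+ 2 / (K - D)) by field; exact: lt0r_neq0.
rewrite oppr_ge0 leNgt divr_gt0 // exprn_even_gt0 //=.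
by rewrite lt_eqF.
Qed.

(* Strong convexity makes minimizing sequences Cauchy; the conclusion is the
   first-order condition at the minimizer of s + (|x|^2 + |u|^2) / 2 on S. *)
Lemma regularized_minimizer (R : realType) (H K : hilbertType R)
    (S : H -> K -> R -> Prop) :
  (exists x u s, S x u s) ->
  (exists b, forall x u s, S x u s -> b <= s + 2^-1 * `|x| ^+ 2 + 2^-1 * `|u| ^+ 2) ->
  (forall t x u s y w r, 0 <= t -> t <= 1 -> S x u s -> S y w r ->
    S (x + t *: (y - x)) (u + t *: (w - u)) (s + t * (r - s))) ->
  (forall X U s x u r, (forall n : nat, S (X n) (U n) (s n)) ->
    X @ \oo --> x -> U @ \oo --> u -> s @ \oo --> r -> S x u r) ->
  exists a b c, S a b c /\
    forall x u s, S x u s -> c - '<[a, x - a]> - '<[b, u - b]> <= s.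
Proof.
move=> [x0 [u0 [s0 S0]]] [lb hlb] cvx cls.
pose f (p : H * K * R) := p.2 + 2^-1 * '<[p.1.1, p.1.1]> + 2^-1 * '<[p.1.2, p.1.2]>.
pose V := [set f p | p in [set p | S p.1.1 p.1.2 p.2]].
have Vinf : has_inf V.
  split; first by exists (f (x0, u0, s0)), (x0, u0, s0).
  by exists lb => _ [[[x u] s] /= /hlb + <-]; rewrite /f /= !inner_norm.
have leV p : S p.1.1 p.1.2 p.2 -> inf V <= f p.
  by move=> Sp; apply: ge_inf; [case: Vinf|exists p].
have : forall n : nat, exists p, S p.1.1 p.1.2 p.2 /\ f p < inf V + harmonic n.
  move=> n; have [_ [p Sp <-] ltp] := inf_adherent (harmonic_gt0 n) Vinf.
  by exists p.
move=> /choice [P hP].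
(* At a midpoint [f] lies below the average of its two values by at least an eighth of the squared
   distance; comparison with [inf V] yields the factor 4. *)
have key n k : '<[(P n).1.1 - (P k).1.1, (P n).1.1 - (P k).1.1]> +
    '<[(P n).1.2 - (P k).1.2, (P n).1.2 - (P k).1.2]> <=
    4 * harmonic n + 4 * harmonic k.
  have [Sn ltn] := hP n; have [Sk ltk] := hP k.
  move: (harmonic n) (harmonic k) ltn ltk => hn hk ltn ltk.
  have h0 : (0 : R) <= 2^-1 by lra.
  have h1 : (2^-1 : R) <= 1 by lra.
  have := cvx 2^-1 _ _ _ _ _ _ h0 h1 Sn Sk.
  move=> Sm; have := leV (_, _, _) Sm; move: ltn ltk; rewrite /f /= !ipE.
  rewrite (ipC (P k).1.1 (P n).1.1) (ipC (P k).1.2 (P n).1.2).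
  lra.
have h40 : (fun n => 4 * @harmonic R n) @ \oo --> 0.
  by rewrite -(mulr0 4); apply: cvgMr; exact: cvg_harmonic.
have cX : cvg ((fun n => (P n).1.1) @ \oo).
  apply: (cvg_of_sqr_dist h40) => n k; rewrite -inner_norm.
  by apply: le_trans (key n k); rewrite lerDl ip_ge0.
have cU : cvg ((fun n => (P n).1.2) @ \oo).
  apply: (cvg_of_sqr_dist h40) => n k; rewrite -inner_norm.
  by apply: le_trans (key n k); rewrite lerDr ip_ge0.
set a := lim ((fun n => (P n).1.1) @ \oo) in cX.
set b := lim ((fun n => (P n).1.2) @ \oo) in cU.
have cf : f \o P @ \oo --> inf V.
  apply: (@squeeze_cvgr _ _ _ _ (cst (inf V)) (fun n => inf V + harmonic n)).
  - by apply: nearW => n; apply/andP; split; [exact: leV (hP n).1|exact: ltW (hP n).2].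
  - exact: cvg_cst.
  - by rewrite -[X in _ --> X]addr0; apply: cvgD; [exact: cvg_cst|exact: cvg_harmonic].
(* Strong convexity says nothing about the third components; their limit is recovered from those of
   [f] and of the two norms. *)
pose c := inf V - 2^-1 * '<[a, a]> - 2^-1 * '<[b, b]>.
have cs : (fun n => (P n).2) @ \oo --> c.
  have -> : (fun n => (P n).2) = (fun n => f (P n) - 2^-1 * '<[(P n).1.1, (P n).1.1]> -
      2^-1 * '<[(P n).1.2, (P n).1.2]>) by apply/funext => n; rewrite /f; ring.
  apply: cvgB; first apply: cvgB => //; apply: cvgMr; exact: cvg_ip.
have Sabc : S a b c by exact: (cls _ _ _ _ _ _ (fun n => (hP n).1) cX cU cs).
exists a, b, c; split=> // x u s Sxus.
(* Minimality is tested along the segment from the minimizer to [(x, u, s)]; after division by [t],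
   the squared-distance remainder keeps a factor [t]. *)
rewrite -subr_ge0; apply: (@ge0_of_affine _ _
  (2^-1 * '<[x - a, x - a]> + 2^-1 * '<[u - b, u - b]>)).
  by rewrite addr_ge0 // mulr_ge0 ?ip_ge0 // invr_ge0.
move=> t t0 t1; have := leV (_, _, _) (cvx t _ _ _ _ _ _ (ltW t0) t1 Sabc Sxus).
rewrite /f /= -(pmulr_rge0 _ t0) -subr_ge0 /c !ipE (ipC x a) (ipC u b).
by congr (_ <= _); field.
Qed.

(** The representer is the minimizer [a] of [2^-1 * |x| ^+ 2 - f x]: the first-order condition,
    tested at [a + x] and [a - x], gives the two inequalities. *)
Lemma riesz (R : realType) (H : hilbertType R) (f : H -> R) (M : R) :
  (forall x y, f (x + y) = f x + f y) ->
  (forall a x, f (a *: x) = a * f x) ->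
  (forall x, `|f x| <= M * `|x|) -> exists w, forall x, f x = '<[w, x]>.
Proof.
move=> fD fZ fM.
have fN x : f (- x) = - f x by rewrite -scaleN1r fZ mulN1r.
have fcvg (X : nat -> H) x : X @ \oo --> x -> f (X n) @[n --> \oo] --> f x.
  move=> Xx; apply/cvgrPdist_le => e e0.
  have M0 : 0 < `|M| + 1 by rewrite ltr_wpDl.
  have /cvgrPdist_le/(_ _ (divr_gt0 e0 M0)) := Xx; apply: filterS => n.
  rewrite ler_pdivlMr // => h; rewrite -fN -fD; apply: (le_trans (fM _)).
  apply: le_trans h; rewrite mulrC ler_wpM2l //.
  by apply: (le_trans (ler_norm _)); rewrite lerDl.
have [||||a [b [c [-> abc]]]] :=
    @regularized_minimizer _ H H (fun x _ s => s = - f x).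
- by exists 0, 0, (- f 0).
(* This is the minimum of [2^-1 * s ^+ 2 - M * s], attained at [s = M]. *)
- exists (- (2^-1 * M ^+ 2)) => x u _ ->.
  have := fM x; rewrite ler_norml => /andP[_].
  have := sqr_ge0 (M - `|x|); have := sqr_ge0 `|u|; nra.
- move=> t x _ _ y _ _ _ _ -> ->.
  by rewrite fD fZ fD fN; ring.
- move=> X U s x u r sX Xx _.
  rewrite (_ : s = fun n => - f (X n)); last exact/funext.
  by move=> sr; apply: (cvg_unique _ sr) => //; apply: cvgN; exact: fcvg.
exists a => x.
have := abc (a + x) b _ erefl; have := abc (a - x) b _ erefl.
rewrite subrr ip0r !subr0 (addrC a) addrK (addrC a) addrK !fD !fN ipNr.
lra.
Qed.

(** * Adjoints, Minty's theorem and weak limits *)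

Section Adjoint.
Context {R : realType} {H G : hilbertType R} (L : {linear H -> G}).
Context (cL : continuous L).

(** [sup] has its meaning only on a nonempty set with an upper bound; continuity of [L] provides the
    bound. *)
Lemma opnorm_has_sup : has_sup [set `|L x| | x in [set x : H | `|x| <= 1]].
Proof.
split; first by exists `|L 0|, 0 => //=; rewrite normr0.
have /linear_bounded_continuous/linear_boundedP/pinfty_ex_gt0[M M0 hM] := cL.
exists M => _ [x /= x1 <-]; apply: (le_trans (hM x)).
by rewrite ler_piMr // ltW.
Qed.

Lemma le_opnorm x : `|L x| <= opnorm L * `|x|.
Proof.
have [->|x0] := eqVneq x 0; first by rewrite linear0 !normr0 mulr0.
have nx : 0 < `|x| by rewrite normr_gt0.
rewrite -ler_pdivrMr //.
have -> : `|L x| / `|x| = `|L (`|x|^-1 *: x)|.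
  by rewrite linearZ normrZ ger0_norm ?invr_ge0 // mulrC.
apply: (sup_upper_bound opnorm_has_sup).
exists (`|x|^-1 *: x) => //=.
by rewrite normrZ ger0_norm ?invr_ge0 // mulVf // lt0r_neq0.
Qed.

(** Riesz representation shows that the set from which [adjoint] selects is nonempty, so [get]
    returns one of its elements. *)
Lemma adjointP x y : '<[L x, y]> = '<[x, adjoint L y]>.
Proof.
have [|||w hw] := @riesz _ H (fun x => '<[L x, y]>) (opnorm L * `|y|).
- by move=> a b; rewrite linearD ipDl.
- by move=> a b; rewrite linearZ ipZl.
- move=> a; apply: (le_trans (cauchy_schwarz _ _)).
  by rewrite mulrAC ler_wpM2r // le_opnorm.
have := @getPex _ [set w : H | forall x : H, '<[L x, y]> = '<[x, w]>].
by apply; exists w => a; rewrite hw ipC.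
Qed.

Lemma adjointB y z : adjoint L (y - z) = adjoint L y - adjoint L z.
Proof. by apply: ip_inj => x; rewrite ipC -adjointP !ipE !(ipC _ x) -!adjointP. Qed.

End Adjoint.

(** * Minty's theorem and resolvents *)

Section Minty.
Context {R : realType} {H : hilbertType R}.
Implicit Types (T : H -> set H).

(** Adjoining the single point [(x, u)] to the graph keeps it monotone, so maximality forces the
    point to be there already. *)
Lemma maximally_monotone_in T : maximally_monotone T ->
  forall x u, (forall y w, T y w -> 0 <= '<[x - y, u - w]>) -> T x u.
Proof.
move=> [mT maxT] x u h.
pose S y := T y `|` [set w | y = x /\ w = u].
suff gS : gr S = gr T by change (gr T (x, u)); rewrite -gS; right.
apply: maxT => [y w y' w'|[y w] Tyw]; last by left.
rewrite /gr /S /= => -[Tyw|[-> ->]] [Tyw'|[-> ->]].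
- exact: mT Tyw Tyw'.
- by rewrite -(opprB x) -(opprB u) ipNl ipNr opprK h.
- exact: h.
- by rewrite !subrr ip0l.
Qed.

(* The point (a, b) minimizes phi(x, u) + (|x|^2 + |u|^2) / 2, where phi is the
   Fitzpatrick function of T, whose epigraph is S below; optimality forces
   b = - a and (a, - a) in the graph of T. *)
Lemma minty0 T : monotone_op T ->
  (forall x u, (forall y w, T y w -> 0 <= '<[x - y, u - w]>) -> T x u) ->
  exists a, T a (- a).
Proof.
move=> mT maxT.
pose S x u s := forall y w, T y w -> '<[x, w]> + '<[y, u]> - '<[y, w]> <= s.
(* The Fitzpatrick function dominates the inner product: a point where it were smaller would be
   monotonically related to the graph, hence in it, and testing it against itself is
   contradictory. *)
have S_ge x u s : S x u s -> '<[x, u]> <= s.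
  move=> Sxus; rewrite leNgt; apply/negP => lts.
  have /Sxus : T x u.
    apply: maxT => y w /Sxus; rewrite !ipE; move: lts; lra.
  by rewrite addrK leNgt lts.
have [T0|] := pselect (exists y w, T y w); last first.
  by move=> nT; exists 0; apply: maxT => y w Tyw; exfalso; apply: nT; exists y, w.
have [||||a [b [c [Sabc hmin]]]] := @regularized_minimizer _ H H S.
- have [y [w Tyw]] := T0; exists y, w, '<[y, w]> => y' w' Tyw'.
  have := mT _ _ _ _ Tyw Tyw'; rewrite !ipE; lra.
- exists 0 => x u s /S_ge; have := ip_ge0 (x + u).
  by rewrite !ipE (ipC u x) !inner_norm; lra.
- move=> t x u s y w r t0 t1 Ss Sr y' w' Tyw'.
  rewrite !ipE.
  have := ler_wpM2l t0 (Sr _ _ Tyw').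
  have t1' : 0 <= 1 - t by lra.
  have := ler_wpM2l t1' (Ss _ _ Tyw').
  nra.
- move=> X U s x u r SX Xx Uu sr y w Tyw.
  apply: (@ler_cvg_to _ _ _ _ (fun n => '<[X n, w]> + '<[y, U n]> - '<[y, w]>)
    s _ _ _ sr); last by apply: nearW => n; exact: SX.
  apply: cvgB; last exact: cvg_cst.
  by apply: cvgD; apply: cvg_ip => //; exact: cvg_cst.
have cab := S_ge _ _ _ Sabc.
(* The point [(- b, - a)] is monotonically related to the graph with surplus [|a + b| ^+ 2]. It thus
   lies in the graph, and taking it as [(y, w)] makes the surplus vanish. *)
have key y w : T y w -> '<[a + b, a + b]> <= '<[- b - y, - a - w]>.
  move=> Tyw; have Syw : S y w '<[y, w]>.
    move=> y' w' Tyw'; have := mT _ _ _ _ Tyw Tyw'; rewrite !ipE; lra.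
  have := hmin _ _ _ Syw; rewrite !ipE (ipC b a) (ipC y a); lra.
have Tba : T (- b) (- a).
  by apply: maxT => y w /key; apply: le_trans; exact: ip_ge0.
have := key _ _ Tba; rewrite !subrr ip0l => ab.
have /ip_eq0/eqP : '<[a + b, a + b]> = 0 by apply/eqP; rewrite eq_le ab ip_ge0.
by rewrite addr_eq0 => /eqP ab0; exists a; rewrite {1}ab0.
Qed.

(** The conclusion says that [p] is a resolvent point of [t T] at [w]. It follows from [minty0] for
    the operator [x |-> t T (w + x)], with [p = w + a]. *)
Lemma minty T : maximally_monotone T ->
  forall t w, 0 < t -> exists p, T p (t^-1 *: (w - p)).
Proof.
move=> maxT t w t0.
have [||a Ta] := @minty0 (fun x => [set u | T (w + x) (t^-1 *: u)]).
- move=> x u y v /= Tx Ty; have := maxT.1 _ _ _ _ Tx Ty.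
  by rewrite opprD addrACA subrr add0r -scalerBr ipZr pmulr_rge0 // invr_gt0.
- move=> x u h /=; apply: (maximally_monotone_in maxT) => y v Tyv.
  have := h (y - w) (t *: v); rewrite /= subrKC scalerA mulVf ?lt0r_neq0 //.
  rewrite scale1r => /(_ Tyv).
  have -> : x - (y - w) = w + x - y by rewrite opprB addrA addrAC addrC addrA addrAC.
  have -> : u - t *: v = t *: (t^-1 *: u - v).
    by rewrite scalerBr scalerA mulfV ?lt0r_neq0 // scale1r.
  by rewrite ipZr pmulr_rge0.
by exists (w + a); rewrite opprD addrA subrr add0r.
Qed.

(** Moreau's decomposition: if [q] is a resolvent point of [t^-1 T] at [t^-1 *: w], then
    [w - t *: q] is one of [t T^-1] at [w]. *)
Lemma minty_inv T :
  (forall t w, 0 < t -> exists p, T p (t^-1 *: (w - p))) ->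
  forall t w, 0 < t -> exists p, inv_op T p (t^-1 *: (w - p)).
Proof.
move=> mT t w t0; have [|q] := mT t^-1 (t^-1 *: w); first by rewrite invr_gt0.
rewrite invrK scalerBr scalerA mulfV ?lt0r_neq0 // scale1r => Tq.
exists (w - t *: q); rewrite /inv_op /= opprB subrKC scalerA mulVf ?lt0r_neq0 //.
by rewrite scale1r.
Qed.

Lemma monotone_inv T : monotone_op T -> monotone_op (inv_op T).
Proof. by move=> mT x u y w xu yw; rewrite ipC; exact: mT xu yw. Qed.

(** [op_fun] picks an element as soon as there is one, so existence turns the resolvent formula into
    an inclusion. *)
Lemma op_fun_resolvent T t y : 0 < t ->
  (exists p, T p (t^-1 *: (y - p))) ->
  T (op_fun (resolvent (scale_op t T)) y)
    (t^-1 *: (y - op_fun (resolvent (scale_op t T)) y)).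
Proof.
move=> t0 [p Tp].
have : resolvent (scale_op t T) y (op_fun (resolvent (scale_op t T)) y).
  apply: getPex; exists p; rewrite /resolvent /inv_op /add_op /=.
  exists p => //; exists (y - p); last by rewrite subrKC.
  exists (t^-1 *: (y - p)) => //; rewrite scalerA mulfV ?lt0r_neq0 //.
  by rewrite scale1r.
move: (op_fun _ _) => q [_ -> [_ [u Tu <-] <-]].
by rewrite addrC addKr scalerA mulVf ?lt0r_neq0 // scale1r.
Qed.

Lemma add_op_fun (T : H -> set H) (f : H -> H) x u :
  add_op T (fun_op f) x u <-> T x (u - f x).
Proof.
split=> [[a Ta [_ -> <-]]|Tx]; first by rewrite addrK.
by exists (u - f x) => //; exists (f x) => //; rewrite subrK.
Qed.

Lemma single_valued_fun_op (T : H -> set H) :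
  single_valued T -> T = fun_op (op_fun T).
Proof.
move=> sT; apply/funext => x; rewrite /fun_op /op_fun.
have [u Tu] := sT x; rewrite Tu; congr [set _].
by have : [set u] (get [set u]) by apply: getPex; exists u.
Qed.

End Minty.

(** * Weak limits along ultrafilters *)

Section WeakLimits.
Context {R : realType}.

(** The image of an ultrafilter is an ultrafilter, here containing the compact segment
    [[- M, M]]. *)
Lemma ultra_cvg_bounded (F : set_system nat) (UF : UltraFilter F)
    (s : nat -> R) (M : R) : (forall n, `|s n| <= M) -> cvg (s @ F).
Proof.
move=> sM.
have UsF : UltraFilter (s @ F).
  split; first exact: fmap_proper_filter.
  move=> G PG sG; apply/seteqP; split=> [A GA|]; last exact: sG.
  have [//|nA] := in_ultra_setVsetC (s @^-1` A) UF.
  have /filter_ex[x [Ax nAx]] : G (A `&` ~` A).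
    by apply: filterI => //; apply: sG; rewrite /= preimage_setC.
  by [].
have := @segment_compact R (- M) M; rewrite compact_ultra => /(_ _ UsF)[|l [_ sl]].
  apply: (@filterS _ F _ setT) => [n _ /=|]; last exact: filterT.
  by rewrite in_itv /= -ler_norml.
by apply/cvg_ex; exists l.
Qed.

(** Weak compactness of balls: the limits of the inner products with [y] form a bounded linear
    functional of [y], which Riesz represents by [w]. *)
Lemma weak_ultra_limit (H : hilbertType R) (F : set_system nat)
    (UF : UltraFilter F) (u : nat -> H) (M : R) : (forall n, `|u n| <= M) ->
  exists w, forall y, '<[u n, y]> @[n --> F] --> '<[w, y]>.
Proof.
move=> uM; pose f y := lim ('<[u n, y]> @[n --> F]).
have b y n : `|'<[u n, y]>| <= M * `|y|.
  by apply: (le_trans (cauchy_schwarz _ _)); rewrite ler_wpM2r.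
have fP y : '<[u n, y]> @[n --> F] --> f y.
  exact: (ultra_cvg_bounded UF (b y)).
have [|||w hw] := @riesz _ H f M.
- move=> x y; apply: (cvg_unique _ (fP (x + y))) => //.
  rewrite (_ : (fun n => '<[u n, x + y]>) = fun n => '<[u n, x]> + '<[u n, y]>).
    exact: cvgD.
  by apply/funext => n; rewrite ipDr.
- move=> a x; apply: (cvg_unique _ (fP (a *: x))) => //.
  rewrite (_ : (fun n => '<[u n, a *: x]>) = fun n => a * '<[u n, x]>).
    exact: cvgMr.
  by apply/funext => n; rewrite ipZr.
- move=> x; apply: (cvgr_to_le (cvg_norm (fP x))).
  exact: (nearW _ (b x)).
by exists w => y; rewrite -hw.
Qed.

(** If convergence failed, the indices at distance at least [e] from the limit would meet every
    neighbourhood of infinity, and some ultrafilter finer than [\oo] would contain them. *)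
Lemma cvg_of_ultra (s : nat -> R) (l : R) :
  (forall F : set_system nat, UltraFilter F -> \oo `<=` F -> s @ F --> l) ->
  s @ \oo --> l.
Proof.
move=> h; apply/cvgrPdist_lt => e e0; apply: contrapT => nh.
pose A := [set n | e <= `|l - s n|].
have PA : ProperFilter (within A \oo).
  split; last exact: within_filter.
  rewrite /within /= => A0; apply: nh; apply: filterS A0 => n An.
  by rewrite ltNge; apply/negP => /An.
have [F [UF AF]] := ultraFilterLemma PA.
have ooF : \oo `<=` F.
  by move=> B oB; apply: AF; apply: filterS oB => n Bn _.
have /cvgrPdist_lt/(_ _ e0) Fl := h F UF ooF.
have FA : F A by apply: AF; exact: withinT.
have [n [/= An]] := filter_ex (filterI FA Fl).
by rewrite ltNge An.
Qed.

End WeakLimits.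

(** * Inertial descent *)

Section RealSequences.
Context {R : realType}.

Lemma nneseries_lty (u : nat -> R) k (M : R) : (forall n, 0 <= u n) ->
  (forall n, \sum_(k <= i < n) u i <= M) ->
  (\sum_(k <= n <oo) (u n)%:E < +oo)%E.
Proof.
move=> u0 uM; apply: (@le_lt_trans _ _ M%:E); last exact: ltry.
apply: lime_le; first by apply: is_cvg_nneseries => n _ _; rewrite lee_fin.
by apply: nearW => n; rewrite sumEFin lee_fin.
Qed.

Lemma cvg0_of_bounded_sums (u : nat -> R) (M : R) : (forall n, 0 <= u n) ->
  (forall n, \sum_(0 <= i < n) u i <= M) -> u @ \oo --> 0.
Proof.
move=> u0 uM; apply: cvg_series_cvg_0.
apply: nondecreasing_is_cvgn; last by exists M => _ [n _ <-]; exact: uM.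
by apply: nondecreasing_series => n _ _; exact: u0.
Qed.

Section InertialDescent.
Context (phi delta a : nat -> R) (alpha gamma sigma : R).
Context (phi0 : forall n, 0 <= phi n) (delta0 : forall n, 0 <= delta n)
  (gamma0 : 0 <= gamma) (sigma0 : 0 < sigma) (alpha1 : alpha < 1)
  (a_ge0 : forall n, 0 <= a n) (a_le : forall n, a n <= alpha) (a00 : a 0 = 0)
  (a_nd : forall n, a n <= a n.+1)
  (descent : forall n, phi n.+2 - phi n.+1 - a n * (phi n.+1 - phi n) <=
     gamma * delta n - (gamma + sigma) * delta n.+1).

(** Energy of the inertial scheme: as [a] is nondecreasing, the descent inequality makes it drop by
    at least [sigma * delta n.+1]. *)
Let mu n := phi n.+1 - a n * phi n + gamma * delta n.

Let mu_descent n : mu n.+1 <= mu n - sigma * delta n.+1.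
Proof.
rewrite /mu; have := descent n.
have := ler_wpM2r (phi0 n.+1) (a_nd n).
lra.
Qed.

Let mu_sum n : sigma * \sum_(0 <= i < n) delta i.+1 <= mu 0 - mu n.
Proof.
elim: n => [|n IH]; first by rewrite big_geq // mulr0 subrr.
by rewrite big_nat_recr //= mulrDr; have := mu_descent n; move: IH; lra.
Qed.

Let mu00 : 0 <= mu 0.
Proof. by rewrite /mu a00 mul0r subr0 addr_ge0 // mulr_ge0. Qed.

Let mu_le n : mu n <= mu 0.
Proof.
rewrite -subr_ge0; apply: le_trans (mu_sum n).
by rewrite mulr_ge0 ?sumr_ge0 // ltW.
Qed.

(** Chosen above [phi 0] and with [alpha * K + mu 0 <= K], so that it is invariant under
    [phi n.+1 <= alpha * phi n + mu 0]. *)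
Let K := phi 0 + mu 0 / (1 - alpha).

Lemma inertial_bounded n : phi n <= K.
Proof.
have al : 0 < 1 - alpha by rewrite subr_gt0.
have m0 : 0 <= mu 0 / (1 - alpha) by rewrite divr_ge0 // ltW.
have mE : mu 0 = (1 - alpha) * (mu 0 / (1 - alpha)).
  by rewrite mulrC divfK // lt0r_neq0.
elim: n => [|n IH]; first by rewrite lerDl.
have := mu_le n; rewrite {1}/mu.
have := ler_wpM2r (phi0 n) (a_le n).
have al0 : 0 <= alpha by exact: le_trans (a_ge0 0) (a_le 0).
have := ler_wpM2l al0 IH.
have := mulr_ge0 gamma0 (delta0 n).
have := mulr_ge0 (ltW al) (phi0 0).
move: mE; rewrite /K; set c := mu 0 / _; move: (mu 0) => m; nra.
Qed.

(** The energy drops telescope and [mu] stays above [- K]. The telescoped sum starts at [delta 1],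
    whence the separate [delta 0]. *)
Lemma inertial_summable : exists S, forall n, \sum_(0 <= i < n) delta i <= S.
Proof.
exists (delta 0 + (mu 0 + K) / sigma) => -[|n].
  rewrite big_geq // addr_ge0 // divr_ge0 //; last exact: ltW.
  by rewrite addr_ge0 // (le_trans (phi0 0) (inertial_bounded 0)).
rewrite big_nat_recl // lerD2l ler_pdivlMr // mulrC.
apply: (le_trans (mu_sum n)); rewrite lerD2l /mu.
have := mulr_ge0 gamma0 (delta0 n); have := phi0 n.+1.
have := inertial_bounded n.
have := ler_wpM2r (phi0 n) (le_trans (a_le n) (ltW alpha1)).
lra.
Qed.

(** Both [mu] and [a] converge by monotonicity, and the limit of [a] is below 1, so [phi n] can be
    solved for in the definition of [mu]. *)
Lemma inertial_cvg : phi n.+1 - phi n @[n --> \oo] --> 0 -> cvg (phi @ \oo).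
Proof.
move=> dphi.
have [S hS] := inertial_summable.
have d0 := cvg0_of_bounded_sums delta0 hS.
have /cvg_ex[l mul] : cvg (mu @ \oo).
  apply: nonincreasing_is_cvgn.
    apply/nonincreasing_seqP => n; apply: (le_trans (mu_descent n)).
    by rewrite gerBl mulr_ge0 // ltW.
  exists (- K) => _ [n _ <-]; rewrite /mu.
  have := mulr_ge0 gamma0 (delta0 n); have := phi0 n.+1.
  have := inertial_bounded n.
  have := ler_wpM2r (phi0 n) (le_trans (a_le n) (ltW alpha1)).
  lra.
have /cvg_ex[b ab] : cvg (a @ \oo).
  apply: nondecreasing_is_cvgn; first exact/nondecreasing_seqP.
  by exists alpha => _ [n _ <-].
have b1 : b < 1.
  by apply: le_lt_trans alpha1; apply: (cvgr_to_le ab); exact: nearW.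
have phiE : phi = fun n =>
    (mu n - gamma * delta n - (phi n.+1 - phi n)) / (1 - a n).
  apply/funext => n; rewrite /mu; field.
  by rewrite subr_eq0 gt_eqF // (le_lt_trans (a_le n)).
apply/cvg_ex; exists ((l - gamma * 0 - 0) / (1 - b)); rewrite {1}phiE.
apply: cvgM; first by apply: cvgB => //; apply: cvgB => //; exact: cvgMr.
apply: cvgV; first by rewrite subr_eq0 gt_eqF.
by apply: cvgB => //; exact: cvg_cst.
Qed.

End InertialDescent.

(** Monotonicity keeps [phi] above [phi r > 0] on [[r, +oo[]. Since [phi r] may be infinite, [e] is
    compared with a finite positive minorant [c]. *)
Lemma cvg0_of_modulus (phi : R -> \bar R) (d e : nat -> R) :
  (forall t, 0 <= t -> (0 <= phi t)%E) ->
  (forall s t, 0 <= s -> s <= t -> (phi s <= phi t)%E) ->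
  (forall t, 0 <= t -> (phi t = 0%E <-> t = 0)) ->
  (forall n, 0 <= d n) -> (forall n, (phi (d n) <= (e n)%:E)%E) ->
  e @ \oo --> 0 -> d @ \oo --> 0.
Proof.
move=> phi0 phi_nd phi_eq0 d0 de e0; apply/cvgrPdist_lt => r r0.
have pr : (0 < phi r)%E.
  rewrite lt0e phi0 ?ltW // andbT; apply/eqP => /(phi_eq0 _ (ltW r0)) r00.
  by rewrite r00 ltxx in r0.
have [c c0 cr] : exists2 c, 0 < c & (c%:E <= phi r)%E.
  case: (phi r) pr => [s|_|//]; first by rewrite lte_fin; exists s.
  by exists 1; rewrite ?leey.
have /cvgrPdist_lt/(_ _ c0) := e0; apply: filterS => n.
rewrite !sub0r !normrN (ger0_norm (d0 n)) => en; rewrite ltNge; apply/negP => rd.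
have : (c%:E <= (e n)%:E)%E.
  by apply: (le_trans cr); apply: le_trans (de n); apply: phi_nd => //; exact: ltW.
by rewrite lee_fin leNgt (le_lt_trans (ler_norm _) en).
Qed.

End RealSequences.

(** * Bounded sequences and one-step estimates *)

Section BoundedSequences.
Context {R : realType} {H : hilbertType R}.

Lemma cvg_ip_bounded0 T (F : set_system T) {FF : Filter F} (u d : T -> H) M :
  (forall t, `|u t| <= M) -> d @ F --> 0 -> '<[u t, d t]> @[t --> F] --> 0.
Proof.
move=> uM d0; apply/norm_cvg0P.
apply: (@squeeze_cvgr _ _ _ _ (cst 0) (fun t => M * `|d t|)).
- apply: nearW => t; rewrite normr_ge0 /=; apply: (le_trans (cauchy_schwarz _ _)).
  by rewrite ler_wpM2r.
- exact: cvg_cst.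
- by rewrite -(mulr0 M); apply: cvgMr; rewrite -(@normr0 _ H); exact: cvg_norm.
Qed.

(** [M + 1] stands in for the square root of [M]. *)
Lemma bounded_of_sqr_dist (u w : nat -> H) (M N : R) :
  (forall n, `|w n| <= N) -> (forall n, '<[u n - w n, u n - w n]> <= M) ->
  forall n, `|u n| <= N + (M + 1).
Proof.
move=> wN uM n; rewrite -(subrK (w n) (u n)) addrC; apply: (le_trans (ler_normD _ _)).
rewrite lerD // -(@ler_pXn2r _ 2) ?nnegrE //.
  rewrite -inner_norm (le_trans (uM n)) //.
  by have := le_trans (ip_ge0 _) (uM n); nra.
by have := le_trans (ip_ge0 _) (uM n); lra.
Qed.

Lemma ip_add_le (a b : H) :
  '<[a + b, a + b]> <= 2 * '<[a, a]> + 2 * '<[b, b]>.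
Proof. by have := ip_ge0 (a - b); rewrite !ipE (ipC b a); lra. Qed.

(* With e = x - x0, the difference of the two sides is
   |q - a2 e|^2 + a |p - x - e|^2. *)
Lemma fbf_step_le (x0 x p q z : H) (a a2 : R) : 0 <= a ->
  let x' := q + p + a2 *: (x - x0) in
  '<[x' - z, x' - z]> - '<[x - z, x - z]>
    - a * ('<[x - z, x - z]> - '<[x0 - z, x0 - z]>) <=
  2 * '<[q, q]> - (1 - a) * '<[x - p, x - p]>
    + (2 * a2 ^+ 2 + 2 * a) * '<[x - x0, x - x0]>
    - 2 * '<[p - z, x - x' + a *: (x - x0)]>.
Proof.
move=> a0 /=.
have := ip_ge0 (q - a2 *: (x - x0)).
have := mulr_ge0 a0 (ip_ge0 (p - x - (x - x0))).
rewrite !ipE (ipC x0 x) (ipC p x) (ipC p x0) (ipC q x0) (ipC q x) (ipC q p).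
rewrite (ipC z x0) (ipC z x) (ipC z p) (ipC z q).
lra.
Qed.

(** Serves to trade part of the gap [x - p] for a negative multiple of the new increment in the
    descent inequality. *)
Lemma fbf_increment_le (x0 x p q : H) (a2 : R) :
  let x' := q + p + a2 *: (x - x0) in
  '<[x' - x, x' - x]> <= 4 * '<[x - p, x - p]> + 4 * '<[q, q]>
    + 2 * a2 ^+ 2 * '<[x - x0, x - x0]>.
Proof.
move=> /=.
have -> : q + p + a2 *: (x - x0) - x = (q - (x - p)) + a2 *: (x - x0).
  by apply: ip_inj => v; rewrite !ipE; ring.
have := ip_add_le (q - (x - p)) (a2 *: (x - x0)).
have := ip_add_le q (- (x - p)).
rewrite ipZl ipZr !ipNl !ipNr opprK; lra.
Qed.

(** Converse direction: two successive increments control the gap, up to the correction [q], so the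
    gap inherits their summability. *)
Lemma fbf_gap_le (x0 x p q : H) (a2 : R) :
  let x' := q + p + a2 *: (x - x0) in
  '<[x - p, x - p]> <= 2 * '<[q, q]> + 4 * '<[x' - x, x' - x]>
    + 4 * a2 ^+ 2 * '<[x - x0, x - x0]>.
Proof.
move=> /=; set e := x - x0; set d := _ - x.
have {1 2}-> : x - p = q + (a2 *: e - d).
  by apply: ip_inj => v; rewrite /d !ipE; ring.
have := ip_add_le q (a2 *: e - d).
have := ip_add_le (a2 *: e) (- d).
rewrite ipZl ipZr !ipNl !ipNr opprK; lra.
Qed.

End BoundedSequences.

(** * The inertial forward-backward-forward iteration *)

(** The product space is handled as dependent families with this squared norm, rather than as a
    Hilbert space of its own. *)
Definition sqn (R : realType) (J : finType) (E : J -> hilbertType R)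
  (X : forall j, E j) : R := \sum_j '<[X j, X j]>.

Section SquaredNorm.
Context {R : realType} {J : finType} {E : J -> hilbertType R}.
Implicit Types X Y : forall j, E j.

Lemma sqn_ge0 X : 0 <= sqn X.
Proof. by apply: sumr_ge0 => j _; exact: ip_ge0. Qed.

Lemma ip_le_sqn X j : '<[X j, X j]> <= sqn X.
Proof. by rewrite /sqn (bigD1 j) //= lerDl sumr_ge0 // => k _; exact: ip_ge0. Qed.

Lemma sum_ip_le X Y (c : R) : 0 < c ->
  2 * \sum_j '<[X j, Y j]> <= c * sqn X + c^-1 * sqn Y.
Proof.
move=> c0; rewrite /sqn !mulr_sumr -big_split /=.
by apply: ler_sum => j _; exact: young_ip.
Qed.

Lemma sqnZ c X : sqn (fun j => c *: X j) = c ^+ 2 * sqn X.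
Proof.
by rewrite /sqn mulr_sumr; apply: eq_bigr => j _; rewrite ipZl ipZr; ring.
Qed.

Lemma cvg_sum (I : finType) (f : I -> nat -> R) (l : I -> R)
    (F : set_system nat) {FF : Filter F} :
  (forall i, f i @ F --> l i) -> \sum_i f i n @[n --> F] --> \sum_i l i.
Proof.
by move=> fl; apply: cvg_big => //; exact: add_continuous.
Qed.

Lemma cvg_sqn0 (X : nat -> forall j, E j) j :
  sqn (X n) @[n --> \oo] --> 0 -> X n j @[n --> \oo] --> 0.
Proof.
move=> X0; apply: cvg_of_ip_dist0.
apply: (@squeeze_cvgr _ _ _ _ (cst 0) (fun n => sqn (X n))) => //.
  by apply: nearW => n; rewrite subr0 ip_ge0 ip_le_sqn.
exact: cvg_cst.
Qed.

End SquaredNorm.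

(** Scalar core of the descent: [Ph'], [Ph], [Ph0] are successive squared distances to a zero, [d']
    and [d] increments, [P] the gap, [q] the forward correction, [t] the square of step size times
    Lipschitz constant, [k] the monotonicity term. *)
Lemma fbf_combine (R : realType) (al a a2 al2 sg t Ph' Ph Ph0 d' d q P k : R) :
  0 < sg -> 0 <= t -> 0 <= a -> a <= al -> 0 <= a2 -> a2 <= al2 ->
  0 <= d -> 0 <= P -> q <= t * P -> 0 <= k ->
  12 * al2 ^+ 2 * (1 + t) + 9 * al + 8 * al * t + 4 * sg * (1 + t) + 2 * t <= 1 ->
  Ph' - Ph - a * (Ph - Ph0) <=
    2 * q - (1 - a) * P + (2 * a2 ^+ 2 + 2 * a) * d - 2 * k ->
  d' <= 4 * P + 4 * q + 2 * a2 ^+ 2 * d ->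
  Ph' - Ph - a * (Ph - Ph0) <= (3 * al2 ^+ 2 + 2 * al) * d
    - (3 * al2 ^+ 2 + 2 * al + sg) * d'.
Proof.
move=> sg0 t0 a0 aal a20 a2al d0 P0 qt k0 par main incr.
have s2 : a2 ^+ 2 <= al2 ^+ 2 by rewrite ler_pXn2r // nnegrE // (le_trans a20).
have al0 : 0 <= al by exact: le_trans aal.
have s20 : 0 <= al2 ^+ 2 by exact: sqr_ge0.
set c := 3 * al2 ^+ 2 + 2 * al + sg.
have c0 : 0 <= c by rewrite /c; lra.
(* The parameter condition rearranged. Once [c] times the increment bound is added, the coefficient
   of [P] is at most [2 * t - (1 - al) + 4 * c * (1 + t)], hence nonpositive. *)
have c4 : 4 * c * (1 + t) <= 1 - al - 2 * t by rewrite /c; lra.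
(* Thus [c] times the term [2 * a2 ^+ 2 * d] is at most half of [a2 ^+ 2 * d], and the total
   coefficient 5/2 fits under the 3 of the conclusion. *)
have c1 : c <= 4^-1.
  have := mulr_ge0 c0 t0; lra.
have h1 := ler_wpM2r P0 c4.
have h2 := ler_wpM2l c0 incr.
have h3 := ler_wpM2l c0 qt.
have h4 := ler_wpM2r P0 aal.
have h5 := ler_wpM2r d0 aal.
have h6 := ler_wpM2r d0 s2.
have h7 := ler_wpM2r (mulr_ge0 (sqr_ge0 a2) d0) c1.
have h8 := mulr_ge0 s20 d0.
rewrite (_ : 3 * al2 ^+ 2 + 2 * al = c - sg) in c0 *; last by rewrite /c; ring.
have cE : c * d = 3 * (al2 ^+ 2 * d) + 2 * (al * d) + sg * d by rewrite /c; ring.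
lra.
Qed.

(** The term [2 * q <= 2 * t * P] is absorbed on the left, where the parameter condition leaves
    [1 - 2 * t >= 4 * sg]. *)
Lemma fbf_gap_combine (R : realType) (al a2 al2 sg t d' d q P : R) :
  0 < sg -> 0 <= t -> 0 <= al -> 0 <= a2 -> a2 <= al2 -> 0 <= d -> 0 <= P ->
  q <= t * P ->
  12 * al2 ^+ 2 * (1 + t) + 9 * al + 8 * al * t + 4 * sg * (1 + t) + 2 * t <= 1 ->
  P <= 2 * q + 4 * d' + 4 * a2 ^+ 2 * d ->
  sg * P <= d' + al2 ^+ 2 * d.
Proof.
move=> sg0 t0 al0 a20 a2al d0 P0 qt par h.
have s2 : a2 ^+ 2 <= al2 ^+ 2 by rewrite ler_pXn2r // nnegrE // (le_trans a20).
have h1 := ler_wpM2r d0 s2.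
have h2 := mulr_ge0 al0 t0; have h3 := mulr_ge0 (sqr_ge0 al2) t0.
have h4 := mulr_ge0 (ltW sg0) t0; have h5 := sqr_ge0 al2.
have h6 : 4 * sg <= 1 - 2 * t by lra.
have h7 := ler_wpM2r P0 h6.
lra.
Qed.

(** * Descent and summability for the iteration on a finite product *)

Section InertialForwardBackwardForward.
Context {R : realType} {J : finType} {E : J -> hilbertType R}.
Context (M : forall j, E j -> set (E j)) (Q : (forall j, E j) -> forall j, E j).
Arguments M : clear implicits.
Context (beta lambda sigma alpha1 alpha2 : R) (lam a1 a2 : nat -> R).
Context (x p : nat -> forall j, E j).
Arguments x : clear implicits.
Arguments p : clear implicits.
Context (M_mono : forall j, monotone_op (M j))
  (M_minty : forall j t w, 0 < t -> exists q, M j q (t^-1 *: (w - q)))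
  (Q_mono : forall X Y, 0 <= \sum_j '<[X j - Y j, Q X j - Q Y j]>)
  (Q_lip : forall X Y, sqn (fun j => Q X j - Q Y j) <=
    beta ^+ 2 * sqn (fun j => X j - Y j))
  (beta0 : 0 < beta) (lambda0 : 0 < lambda) (sigma0 : 0 < sigma)
  (lam_ge : forall n, lambda <= lam n)
  (par : forall n, 12 * alpha2 ^+ 2 * (1 + (lam n * beta) ^+ 2)
    + 9 * (alpha1 + alpha2) + 8 * (alpha1 + alpha2) * (lam n * beta) ^+ 2
    + 4 * sigma * (1 + (lam n * beta) ^+ 2) + 2 * (lam n * beta) ^+ 2 <= 1)
  (a1_nd : forall n, a1 n <= a1 n.+1) (a2_nd : forall n, a2 n <= a2 n.+1)
  (a1_0 : a1 0 = 0) (a2_0 : a2 0 = 0)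
  (a1_ge0 : forall n, 0 <= a1 n) (a2_ge0 : forall n, 0 <= a2 n)
  (a1_le : forall n, a1 n <= alpha1) (a2_le : forall n, a2 n <= alpha2)
  (pP : forall n j, M j (p n j) ((lam n)^-1 *: (x n.+1 j
    - lam n *: Q (x n.+1) j + a1 n *: (x n.+1 j - x n j) - p n j)))
  (xP : forall n j, x n.+2 j = lam n *: (Q (x n.+1) j - Q (p n) j) + p n j
    + a2 n *: (x n.+1 j - x n j)).

(** By the resolvent inclusion [pP], this is an element of [M + Q] at [p n]. *)
Definition fbf_residual n j : E j :=
  (lam n)^-1 *: (x n.+1 j + a1 n *: (x n.+1 j - x n j) - p n j)
  + (Q (p n) j - Q (x n.+1) j).

Let zero z := forall j, M j (z j) (- Q z j).
Let delta n := sqn (fun j => x n.+1 j - x n j).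
Let dist z n := sqn (fun j => x n j - z j).
(** The indices are shifted: [p n] is computed from [x n.+1] and [x n]. *)
Let gap n := sqn (fun j => x n.+1 j - p n j).

Let lam0 n : 0 < lam n. Proof. exact: lt_le_trans (lam_ge n). Qed.
Let lamN0 n : lam n != 0. Proof. exact: lt0r_neq0. Qed.

(** The contribution of [M] is nonnegative for each [j], that of [Q] only after summation, because
    [Q] couples the components. *)
Let residual_monotone n y v : (forall j, M j (y j) (v j)) ->
  0 <= \sum_j '<[p n j - y j, fbf_residual n j - (v j + Q y j)]>.
Proof.
move=> yv.
have h j : 0 <= '<[p n j - y j, fbf_residual n j - Q (p n) j - v j]>.
  have -> : fbf_residual n j - Q (p n) j = (lam n)^-1 *: (x n.+1 j
    - lam n *: Q (x n.+1) j + a1 n *: (x n.+1 j - x n j) - p n j).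
    by apply: ip_inj => w; rewrite /fbf_residual !ipE; field.
  exact: M_mono (pP n j) (yv j).
apply: (@le_trans _ _ (\sum_j '<[p n j - y j, fbf_residual n j - Q (p n) j - v j]>
    + \sum_j '<[p n j - y j, Q (p n) j - Q y j]>)).
  by rewrite addr_ge0 // sumr_ge0.
rewrite -big_split /= le_eqVlt; apply/orP; left; apply/eqP.
by apply: eq_bigr => j _; rewrite !ipE; ring.
Qed.

Let residual_zero n z : zero z ->
  0 <= \sum_j '<[p n j - z j, fbf_residual n j]>.
Proof.
move=> zz; apply: le_trans (residual_monotone n zz) _.
rewrite le_eqVlt; apply/orP; left; apply/eqP.
by apply: eq_bigr => j _; rewrite addNr subr0.
Qed.

Let QdE n : sqn (fun j => lam n *: (Q (x n.+1) j - Q (p n) j)) <=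
  (lam n * beta) ^+ 2 * gap n.
Proof.
rewrite (sqnZ _ (fun j => Q (x n.+1) j - Q (p n) j)) exprMn -[leRHS]mulrA.
by apply: ler_wpM2l; [exact: sqr_ge0|exact: Q_lip].
Qed.

Let descent z n : zero z ->
  dist z n.+2 - dist z n.+1 - (a1 n + a2 n) * (dist z n.+1 - dist z n) <=
  (3 * alpha2 ^+ 2 + 2 * (alpha1 + alpha2)) * delta n -
  (3 * alpha2 ^+ 2 + 2 * (alpha1 + alpha2) + sigma) * delta n.+1.
Proof.
move=> zz.
(* [lam n] times the residual is exactly this combination of increments. *)
have kk : 0 <= \sum_j '<[p n j - z j, x n.+1 j - x n.+2 j
    + (a1 n + a2 n) *: (x n.+1 j - x n j)]>.
  have := mulr_ge0 (ltW (lam0 n)) (residual_zero n zz).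
  rewrite mulr_sumr; congr (_ <= _); apply: eq_bigr => j _; rewrite xP /fbf_residual !ipE.
  by field; exact: lamN0.
apply: (fbf_combine (a2 := a2 n) (t := (lam n * beta) ^+ 2)
  (q := sqn (fun j => lam n *: (Q (x n.+1) j - Q (p n) j))) (P := gap n) (k := _)
  _ _ _ _ _ _ _ _ (QdE n) kk (par n)) => //.
- exact: sqr_ge0.
- by rewrite addr_ge0.
- by rewrite lerD.
- exact: sqn_ge0.
- exact: sqn_ge0.
- have := @ler_sum _ _ (index_enum J) xpredT _ _ (fun j _ =>
    fbf_step_le (x n j) (x n.+1 j) (p n j)
    (lam n *: (Q (x n.+1) j - Q (p n) j)) (z j) (a2 n)
    (addr_ge0 (a1_ge0 n) (a2_ge0 n))).
  rewrite /=; under eq_bigr do rewrite -xP.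
  under [in leRHS]eq_bigr do rewrite -?xP.
    by rewrite !(big_split, sumrN, =^~ mulr_sumr).
- have := @ler_sum _ _ (index_enum J) xpredT _ _ (fun j _ =>
    fbf_increment_le (x n j) (x n.+1 j) (p n j)
    (lam n *: (Q (x n.+1) j - Q (p n) j)) (a2 n)).
  rewrite /=; under eq_bigr do rewrite -xP.
  by rewrite !(big_split, sumrN, =^~ mulr_sumr).
Qed.


Let alpha1_ge0 : 0 <= alpha1. Proof. exact: le_trans (a1_ge0 0) (a1_le 0). Qed.
Let alpha2_ge0 : 0 <= alpha2. Proof. exact: le_trans (a2_ge0 0) (a2_le 0). Qed.
Let gamma := 3 * alpha2 ^+ 2 + 2 * (alpha1 + alpha2).

Let gamma_ge0 : 0 <= gamma.
Proof. by rewrite addr_ge0 // mulr_ge0 ?sqr_ge0 // addr_ge0. Qed.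

Let alpha_lt1 : alpha1 + alpha2 < 1.
Proof.
have := par 0; have t0 := sqr_ge0 (lam 0 * beta).
have al0 : 0 <= alpha1 + alpha2 by exact: addr_ge0.
have := mulr_ge0 al0 t0; have := mulr_ge0 (sqr_ge0 alpha2) t0.
have := mulr_ge0 (ltW sigma0) t0; have := sqr_ge0 alpha2.
move: t0 al0 sigma0; set t := (lam 0 * beta) ^+ 2; set al := alpha1 + alpha2.
by set s := alpha2 ^+ 2; lra.
Qed.

Let a n := a1 n + a2 n.
Let a_ge0 n : 0 <= a n. Proof. exact: addr_ge0. Qed.
Let a_le n : a n <= alpha1 + alpha2. Proof. exact: lerD. Qed.
Let a_nd n : a n <= a n.+1. Proof. exact: lerD. Qed.
Let a_0 : a 0 = 0. Proof. by rewrite /a a1_0 a2_0 addr0. Qed.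

Let dist_ge0 z n : 0 <= dist z n. Proof. exact: sqn_ge0. Qed.
Let delta_ge0 n : 0 <= delta n. Proof. exact: sqn_ge0. Qed.
Let gap_ge0 n : 0 <= gap n. Proof. exact: sqn_ge0. Qed.

Let dist_bounded z : zero z -> exists K, forall n, dist z n <= K.
Proof.
move=> zz; eexists => n.
exact: (inertial_bounded (dist_ge0 z) delta_ge0 gamma_ge0 sigma0 alpha_lt1 a_ge0
  a_le a_0 a_nd (fun n => descent n zz)).
Qed.

Lemma fbf_increment_summable z : (forall j, M j (z j) (- Q z j)) ->
  exists S, forall n, \sum_(0 <= i < n) sqn (fun j => x i.+1 j - x i j) <= S.
Proof.
move=> zz.
exact: (inertial_summable (dist_ge0 z) delta_ge0 gamma_ge0 sigma0 alpha_lt1 a_ge0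
  a_le a_0 a_nd (fun n => descent n zz)).
Qed.

Let gap_le n : sigma * gap n <= delta n.+1 + alpha2 ^+ 2 * delta n.
Proof.
have := @ler_sum _ _ (index_enum J) xpredT _ _ (fun j _ =>
  fbf_gap_le (x n j) (x n.+1 j) (p n j)
    (lam n *: (Q (x n.+1) j - Q (p n) j)) (a2 n)).
rewrite /=; under [in leRHS]eq_bigr do rewrite -?xP.
rewrite !(big_split, sumrN, =^~ mulr_sumr) => h.
exact: (fbf_gap_combine sigma0 (sqr_ge0 _) (addr_ge0 alpha1_ge0 alpha2_ge0)
  (a2_ge0 n) (a2_le n) (delta_ge0 n) (gap_ge0 n) (QdE n) (par n) h).
Qed.

Lemma fbf_gap_summable z : (forall j, M j (z j) (- Q z j)) ->
  exists S, forall n, \sum_(0 <= i < n) sqn (fun j => x i.+1 j - p i j) <= S.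
Proof.
move=> /fbf_increment_summable [S hS].
exists ((S + alpha2 ^+ 2 * S) / sigma) => n.
rewrite ler_pdivlMr // mulrC mulr_sumr.
apply: (@le_trans _ _ (\sum_(0 <= i < n) (delta i.+1 + alpha2 ^+ 2 * delta i))).
  by apply: ler_sum => i _; exact: gap_le.
rewrite big_split -mulr_sumr /= lerD //; last by rewrite ler_wpM2l ?sqr_ge0 // hS.
by have := hS n.+1; rewrite big_nat_recl //=; apply: le_trans; rewrite lerDr delta_ge0.
Qed.

(** * Weak and strong convergence of the iteration *)

Section Convergence.
Context (z0 : forall j, E j) (z0P : zero z0).

Let delta_cvg0 : delta @ \oo --> 0.
Proof.
have [S hS] := fbf_increment_summable z0P.
exact: cvg0_of_bounded_sums delta_ge0 hS.
Qed.

Let gap_cvg0 : gap @ \oo --> 0.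
Proof.
have [S hS] := fbf_gap_summable z0P.
exact: cvg0_of_bounded_sums gap_ge0 hS.
Qed.

Lemma fbf_increment_cvg0 j : x n.+1 j - x n j @[n --> \oo] --> 0.
Proof. exact: (cvg_sqn0 (X := fun n j => x n.+1 j - x n j) delta_cvg0). Qed.

Lemma fbf_gap_cvg0 j : x n.+1 j - p n j @[n --> \oo] --> 0.
Proof. exact: (cvg_sqn0 (X := fun n j => x n.+1 j - p n j) gap_cvg0). Qed.

(** The step sizes stay above [lambda], so [(lam n)^-1] is bounded and the residual is controlled by
    [gap] and [delta]. *)
Lemma fbf_residual_cvg0 j : fbf_residual n j @[n --> \oo] --> 0.
Proof.
apply: (cvg_sqn0 (X := fbf_residual)).
pose c := lambda^-1 ^+ 2.
apply: (@squeeze_cvgr _ _ _ _ (cst 0) (fun n => 4 * c * gap n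
   + 4 * c * alpha1 ^+ 2 * delta n + 2 * beta ^+ 2 * gap n)).
- apply: nearW => n; rewrite sqn_ge0 /=.
  have le_c : (lam n)^-1 ^+ 2 <= c.
    by rewrite ler_pXn2r ?nnegrE ?invr_ge0 ?(ltW (lam0 n)) ?(ltW lambda0) // lef_pV2 ?posrE.
  have le_a : a1 n ^+ 2 <= alpha1 ^+ 2 by rewrite ler_pXn2r // nnegrE.
  have h1 : sqn (fbf_residual n) <= 2 * ((lam n)^-1 ^+ 2 *
      (2 * gap n + 2 * (a1 n ^+ 2 * delta n))) + 2 * sqn (fun j => Q (p n) j - Q (x n.+1) j).
    rewrite /gap /delta /sqn !(mulr_sumr, =^~ big_split) /=.
    apply: ler_sum => k _; apply: (le_trans (ip_add_le _ _)); rewrite lerD2r.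
    rewrite ler_wpM2l // ipZl ipZr mulrA -expr2 ler_wpM2l ?sqr_ge0 //.
    rewrite addrAC; apply: (le_trans (ip_add_le _ _)).
    by rewrite ipZl ipZr [a1 n * (_ * _)]mulrA -expr2.
  have h2 : sqn (fun j => Q (p n) j - Q (x n.+1) j) <= beta ^+ 2 * gap n.
    apply: (le_trans (Q_lip _ _)); rewrite ler_wpM2l ?sqr_ge0 // /gap /sqn.
    by apply: ler_sum => k _; rewrite -opprB ipNl ipNr opprK.
  have h3 := ler_wpM2r (delta_ge0 n) le_a.
  have h4 := ler_wpM2r (gap_ge0 n) le_c.
  have h5 : (lam n)^-1 ^+ 2 * (a1 n ^+ 2 * delta n) <= c * (alpha1 ^+ 2 * delta n).
    by rewrite ler_pM ?sqr_ge0 // mulr_ge0 ?sqr_ge0.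
  lra.
- exact: cvg_cst.
- rewrite (_ : 0 = 4 * c * 0 + 4 * c * alpha1 ^+ 2 * 0 + 2 * beta ^+ 2 * 0 :> R).
    by apply: cvgD; [apply: cvgD|]; exact: cvgMr.
  by rewrite !mulr0 !addr0.
Qed.

Let x_bounded j : exists K, forall n, `|x n j| <= K.
Proof.
have [K hK] := dist_bounded z0P.
eexists => n.
apply: (@bounded_of_sqr_dist _ _ (fun n => x n j) (cst (z0 j)) K `|z0 j|) => // k.
exact: le_trans (ip_le_sqn (fun j => x k j - z0 j) j) (hK k).
Qed.

Let p_bounded j : exists K, forall n, `|p n j| <= K.
Proof.
have [K hK] := x_bounded j; have [S hS] := fbf_gap_summable z0P.
eexists => n.
apply: (@bounded_of_sqr_dist _ _ (fun n => p n j) (fun n => x n.+1 j) S K) => // k.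
rewrite -opprB ipNl ipNr opprK.
apply: (le_trans (ip_le_sqn (fun j => x k.+1 j - p k j) j)).
apply: le_trans (hS k.+1); rewrite big_nat_recr //= lerDr.
by rewrite sumr_ge0 // => i _; exact: gap_ge0.
Qed.

Let dist_cvg z : zero z -> cvg (dist z @ \oo).
Proof.
move=> zz.
apply: (inertial_cvg (dist_ge0 z) delta_ge0 gamma_ge0 sigma0 alpha_lt1 a_ge0
  a_le a_0 a_nd (fun n => descent n zz)).
(* Successive squared distances differ by twice the inner product of a bounded and a vanishing
   sequence, plus a vanishing square. *)
rewrite (_ : (fun n => _) = fun n => \sum_j (2 * '<[x n j - z j, x n.+1 j - x n j]>
    + '<[x n.+1 j - x n j, x n.+1 j - x n j]>)); last first.
  apply/funext => n; rewrite /dist /sqn -sumrB; apply: eq_bigr => j _.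
  rewrite !ipE (ipC (x n.+1 j) (x n j)) (ipC (z j) (x n j)) (ipC (z j) (x n.+1 j)).
  ring.
rewrite [X in _ --> X](_ : 0 = \sum_(j : J) (2 * 0 + 0) :> R); last first.
  by rewrite mulr0 addr0 big1.
apply: cvg_sum => j; apply: cvgD.
  apply: cvgMr; have [K hK] := x_bounded j.
  apply: (@cvg_ip_bounded0 _ _ _ _ _ _ _ (K + `|z j|)); last exact: fbf_increment_cvg0.
  by move=> n; rewrite (le_trans (ler_normB _ _)) // lerD2r.
rewrite -(ip0l (0 : E j)); apply: cvg_ip; exact: fbf_increment_cvg0.
Qed.

Let finer (F : set_system nat) (G : hilbertType R) (f : nat -> G) (l : G) :
  \oo `<=` F -> f @ \oo --> l -> f @ F --> l.
Proof. by move=> ooF fl B /fl; exact: ooF. Qed.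

Let p_cvg (F : set_system nat) (FF : Filter F) (ooF : \oo `<=` F) j (w y : E j) :
  '<[x n j, y]> @[n --> F] --> '<[w, y]> -> '<[p n j, y]> @[n --> F] --> '<[w, y]>.
Proof.
move=> xw.
rewrite (_ : (fun n => _) = fun n => '<[x n j, y]> +
    '<[x n.+1 j - x n j, y]> - '<[x n.+1 j - p n j, y]>); last first.
  by apply/funext => n; rewrite !ipE; ring.
rewrite (_ : '<[w, y]> = '<[w, y]> + '<[0, y]> - '<[0, y]>); last first.
  by rewrite addrK.
apply: cvgB; first apply: cvgD; first exact: xw.
  by apply: cvg_ip; [apply: finer => //; exact: fbf_increment_cvg0|exact: cvg_cst].
by apply: cvg_ip; [apply: finer => //; exact: fbf_gap_cvg0|exact: cvg_cst].
Qed.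

Section Ultra.
Context (F : set_system nat) (UF : UltraFilter F) (ooF : \oo `<=` F)
  (w : forall j, E j)
  (xw : forall j y, '<[x n j, y]> @[n --> F] --> '<[w j, y]>).

(* Minty's trick: test the limiting inequality against the resolvent of t M at
   w - t Q w, for t so small that I + t Q is injective. *)
Lemma fbf_cluster_zero : zero w.
Proof.
have lim_mono y v : (forall j, M j (y j) (v j)) ->
    0 <= \sum_j '<[w j - y j, - (v j + Q y j)]>.
  move=> yv; suff lim : \sum_j '<[p n j - y j, fbf_residual n j - (v j + Q y j)]>
      @[n --> F] --> \sum_j '<[w j - y j, - (v j + Q y j)]>.
    by apply: (cvgr_to_ge lim); apply: nearW => n; exact: residual_monotone.
  apply: cvg_sum => j.
  rewrite (_ : (fun n => _) = fun n => '<[p n j - y j, fbf_residual n j]> +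
     '<[p n j, - (v j + Q y j)]> - '<[y j, - (v j + Q y j)]>); last first.
    by apply/funext => n; rewrite !ipE; ring.
  rewrite (_ : '<[w j - y j, - (v j + Q y j)]> = 0 +
    '<[w j, - (v j + Q y j)]> - '<[y j, - (v j + Q y j)]>); last first.
    by rewrite !ipE; ring.
  apply: cvgB; last exact: cvg_cst.
  apply: cvgD; last by apply: p_cvg => //; exact: xw.
  have [K hK] := p_bounded j.
  apply: (@cvg_ip_bounded0 _ _ _ _ _ _ _ (K + `|y j|)).
    by move=> n; rewrite (le_trans (ler_normB _ _)) // lerD2r.
  apply: finer => //; exact: fbf_residual_cvg0.
(* Here [t^-1] exceeds the Lipschitz constant by one, so the tested sum, which is nonnegative, is at
   most minus the squared distance from [w] to [y]. *)
pose t := (beta + 1)^-1; have b1 : 0 < beta + 1 by rewrite addr_gt0.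
have t0 : 0 < t by rewrite invr_gt0.
have : forall j, {y | M j y (t^-1 *: (w j - t *: Q w j - y))}.
  by move=> j; apply: cid; exact: M_minty.
move=> /all_sig[y yP].
have := lim_mono y _ yP.
have -> : \sum_j '<[w j - y j, - (t^-1 *: (w j - t *: Q w j - y j) + Q y j)]> =
   \sum_j '<[w j - y j, Q w j - Q y j]> - (beta + 1) * sqn (fun j => w j - y j).
  rewrite /sqn mulr_sumr -sumrB; apply: eq_bigr => j _.
  rewrite /t invrK !ipE; field; exact: lt0r_neq0.
have := sum_ip_le (fun j => w j - y j) (fun j => Q w j - Q y j) beta0.
have bi : 0 <= beta^-1 by rewrite invr_ge0 ltW.
have := ler_wpM2l bi (Q_lip w y).
rewrite (_ : beta^-1 * (beta ^+ 2 * _) = beta * sqn (fun j => w j - y j)); last first.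
  by field; exact: lt0r_neq0.
set D := sqn (fun j => w j - y j) => h1 h2 h3.
have D0 : D <= 0 by lra.
move=> j; have yw : y j = w j.
  apply/esym/eqP; rewrite -subr_eq0; apply/eqP/ip_eq0/eqP; rewrite eq_le ip_ge0 andbT.
  exact: le_trans (ip_le_sqn (fun j => w j - y j) j) D0.
have := yP j; rewrite yw addrAC subrr sub0r scalerN scalerA mulVf ?scale1r //.
exact: lt0r_neq0.
Qed.

End Ultra.

Let ultra_limit (F : set_system nat) : UltraFilter F -> \oo `<=` F ->
  {w | zero w /\ forall j y, '<[x n j, y]> @[n --> F] --> '<[w j, y]>}.
Proof.
move=> UF ooF.
have : forall j, {w : E j | forall y, '<[x n j, y]> @[n --> F] --> '<[w, y]>}.
  by move=> j; apply: cid; have [K hK] := x_bounded j; exact: (weak_ultra_limit UF hK).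
move=> /all_sig[w xw]; exists w; split=> //.
exact: (@fbf_cluster_zero F UF ooF w xw).
Qed.

(* Opial's argument: the difference of the convergent sequences |x_n - w|^2 and
   |x_n - w'|^2 is affine in x_n, so weak limits w, w' along two ultrafilters agree. *)
Let ultra_limit_unique (F F' : set_system nat) (w w' : forall j, E j) :
  UltraFilter F -> UltraFilter F' -> \oo `<=` F -> \oo `<=` F' ->
  zero w -> zero w' ->
  (forall j y, '<[x n j, y]> @[n --> F] --> '<[w j, y]>) ->
  (forall j y, '<[x n j, y]> @[n --> F'] --> '<[w' j, y]>) ->
  forall j, w j = w' j.
Proof.
move=> UF UF' ooF ooF' zw zw' xw xw' j.
pose s n := \sum_j '<[x n j, w j - w' j]>.
have /cvg_ex[c sc] : cvg (s @ \oo).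
  have /cvg_ex[l hl] := dist_cvg zw; have /cvg_ex[l' hl'] := dist_cvg zw'.
  have -> : s = fun n => 2^-1 * (\sum_j ('<[w j, w j]> - '<[w' j, w' j]>)
      - (dist w n - dist w' n)).
    apply/funext => n; rewrite /s /dist /sqn -!sumrB mulr_sumr.
    apply: eq_bigr => k _; rewrite !ipE (ipC (w k) (x n k)) (ipC (w' k) (x n k)).
    by field.
  apply/cvg_ex; eexists; apply: cvgMr; apply: cvgB; first exact: cvg_cst.
  exact: cvgB hl hl'.
have sF : s @ F --> \sum_j '<[w j, w j - w' j]> by apply: cvg_sum => k; exact: xw.
have sF' : s @ F' --> \sum_j '<[w' j, w j - w' j]> by apply: cvg_sum => k; exact: xw'.
have scF : s @ F --> c by move=> B /sc; exact: ooF.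
have scF' : s @ F' --> c by move=> B /sc; exact: ooF'.
have e1 := cvg_unique _ sF scF; have e2 := cvg_unique _ sF' scF'.
have D0 : sqn (fun j => w j - w' j) = 0.
  rewrite -(subrr c) -{1}e1 // -e2 // /sqn -sumrB; apply: eq_bigr => k _.
  by rewrite ipDl ipNl.
apply/eqP; rewrite -subr_eq0; apply/eqP/ip_eq0/eqP; rewrite eq_le ip_ge0 andbT.
by apply: le_trans (ip_le_sqn (fun j => w j - w' j) j) _; rewrite D0.
Qed.

(** One ultrafilter supplies [w], every other one finer than [\oo] gives the same limit, and
    [cvg_of_ultra] concludes. The last clause feeds the strong convergence. *)
Lemma fbf_weak_cvg : exists w : forall j, E j,
  [/\ forall j, M j (w j) (- Q w j),
      forall j, weakly_cvg (fun n => x n j) (w j),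
      forall j, weakly_cvg (fun n => p n j) (w j) &
      \sum_j '<[p n j - w j, fbf_residual n j]> @[n --> \oo] --> 0].
Proof.
have PF : ProperFilter (\oo : set_system nat) by exact: eventually_filter.
have [F [UF ooF]] := ultraFilterLemma PF.
have [w [zw xwF]] := ultra_limit UF ooF.
have xw j y : '<[x n j, y]> @[n --> \oo] --> '<[w j, y]>.
  apply: cvg_of_ultra => F' UF' ooF'.
  have [w' [zw' xw']] := ultra_limit UF' ooF'.
  by rewrite (ultra_limit_unique UF UF' ooF ooF' zw zw' xwF xw').
exists w; split=> //; first by move=> j y; exact: p_cvg.
rewrite [X in _ --> X](_ : 0 = \sum_(j : J) 0 :> R); last by rewrite big1.
apply: cvg_sum => j; have [K hK] := p_bounded j.
apply: (@cvg_ip_bounded0 _ _ _ _ _ _ _ (K + `|w j|)); last exact: fbf_residual_cvg0.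
by move=> n; rewrite (le_trans (ler_normB _ _)) // lerD2r.
Qed.

(** Each [T j n] is nonnegative by monotonicity of [M j + K j]. The skew part [S] drops out of their
    sum, which is the pairing tending to zero; hence [T j0 n], which dominates the modulus, tends to
    zero. *)
Lemma fbf_strong_cvg (K : forall j, E j -> E j) (S : (forall j, E j) -> forall j, E j)
    (w : forall j, E j) j0 :
  (forall X j, Q X j = K j (X j) + S X j) ->
  (forall j, monotone_op (fun_op (K j))) ->
  (forall X Y, \sum_j '<[X j - Y j, S X j - S Y j]> = 0) ->
  (forall j, M j (w j) (- Q w j)) ->
  \sum_j '<[p n j - w j, fbf_residual n j]> @[n --> \oo] --> 0 ->
  uniformly_monotone_at (add_op (M j0) (fun_op (K j0))) (w j0) ->
  p n j0 @[n --> \oo] --> w j0.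
Proof.
move=> QE K_mono skew zw lim [_ [phi [phi0 phi_nd phi_eq0 phiP]]].
pose T j n := '<[w j - p n j, - S w j - (fbf_residual n j - S (p n) j)]>.
have graph_p n j : M j (p n j) (fbf_residual n j - S (p n) j - K j (p n j)).
  rewrite (_ : _ - _ - _ = (lam n)^-1 *: (x n.+1 j
    - lam n *: Q (x n.+1) j + a1 n *: (x n.+1 j - x n j) - p n j)); first exact: pP.
  by apply: ip_inj => y; rewrite /fbf_residual [Q (p n) j]QE !ipE; field.
have graph_w j : M j (w j) (- S w j - K j (w j)).
  by have := zw j; rewrite QE opprD addrC.
have T_ge0 j n : 0 <= T j n.
  have := M_mono (graph_w j) (graph_p n j).
  have := K_mono j (w j) (K j (w j)) (p n j) (K j (p n j)) erefl erefl.
  by rewrite /T !ipE; lra.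
have T_sum n : \sum_j T j n = \sum_j '<[p n j - w j, fbf_residual n j]>.
  rewrite (eq_bigr (fun j => '<[p n j - w j, fbf_residual n j]> -
    '<[p n j - w j, S (p n) j - S w j]>)) ?sumrB ?skew ?subr0 // => j _.
  by rewrite /T !ipE; ring.
apply: cvg_of_ip_dist0.
suff : `|w j0 - p n j0| @[n --> \oo] --> 0.
  move=> d0; rewrite (_ : (fun n => _) = fun n => `|w j0 - p n j0| * `|w j0 - p n j0|).
    by rewrite -(mulr0 0); exact: cvgM.
  by apply/funext => n; rewrite inner_norm distrC expr2.
apply: (cvg0_of_modulus phi0 phi_nd phi_eq0 _ _ lim) => // n.
apply: (le_trans (phiP (- S w j0) (p n j0) (fbf_residual n j0 - S (p n) j0) _ _)).
- by apply/add_op_fun; exact: graph_w.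
- by apply/add_op_fun; exact: graph_p.
- by rewrite lee_fin -T_sum (bigD1 j0) //= lerDl sumr_ge0.
Qed.

End Convergence.

(** The splitting of [Q] and the block [j0] are quantified after [w], so a single limit serves all
    the strong convergence claims. *)
Theorem inertial_fbf z0 : (forall j, M j (z0 j) (- Q z0 j)) ->
  [/\ exists B, forall n, \sum_(0 <= i < n) sqn (fun j => x i.+1 j - x i j) <= B,
      exists B, forall n, \sum_(0 <= i < n) sqn (fun j => x i.+1 j - p i j) <= B,
      forall j, x n.+1 j - p n j @[n --> \oo] --> 0 &
      exists w : forall j, E j,
      [/\ forall j, M j (w j) (- Q w j),
          forall j, weakly_cvg (fun n => x n j) (w j),
          forall j, weakly_cvg (fun n => p n j) (w j) &
          forall (K : forall j, E j -> E j)
              (S : (forall j, E j) -> forall j, E j) (j0 : J),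
            (forall X j, Q X j = K j (X j) + S X j) ->
            (forall j, monotone_op (fun_op (K j))) ->
            (forall X Y, \sum_j '<[X j - Y j, S X j - S Y j]> = 0) ->
            uniformly_monotone_at (add_op (M j0) (fun_op (K j0))) (w j0) ->
            p n j0 @[n --> \oo] --> w j0]].
Proof.
move=> z0P; split.
- exact: fbf_increment_summable z0P.
- exact: fbf_gap_summable z0P.
- by move=> j; exact: (@fbf_gap_cvg0 z0 z0P j).
have [w [zw xw pw lim]] := fbf_weak_cvg z0P.
by exists w; split=> // K S j0 QE K_mono skew; exact: fbf_strong_cvg.
Qed.

End InertialForwardBackwardForward.

(** * Primal-dual systems *)

Lemma big_option (R : nmodType) (I : finType) (F : option I -> R) :
  \sum_o F o = F None + \sum_i F (Some i).
Proof.
rewrite (bigD1 None) //=; congr (_ + _).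
rewrite (reindex_omap Some id) /=; last by case.
by apply: eq_bigl => i; rewrite eqxx.
Qed.

(** Minkowski's inequality without square roots: the Young weight [d / c] makes both halves of the
    cross term equal to [c * d * D]. *)
Lemma sqn_add_le (R : realType) (J : finType) (E : J -> hilbertType R)
    (X Y : forall j, E j) (c d D : R) : 0 < c -> 0 < d ->
  sqn X <= c ^+ 2 * D -> sqn Y <= d ^+ 2 * D ->
  sqn (fun j => X j + Y j) <= (c + d) ^+ 2 * D.
Proof.
move=> c0 d0 hX hY.
have -> : sqn (fun j => X j + Y j) = sqn X + 2 * (\sum_j '<[X j, Y j]>) + sqn Y.
  rewrite /sqn mulr_sumr -!big_split /=; apply: eq_bigr => j _.
  by rewrite !ipE (ipC (Y j) (X j)); ring.
have := sum_ip_le X Y (divr_gt0 d0 c0).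
have := ler_wpM2l (ltW (divr_gt0 d0 c0)) hX.
have := ler_wpM2l (ltW (divr_gt0 c0 d0)) hY.
rewrite invf_div.
rewrite (_ : d / c * (c ^+ 2 * D) = c * d * D); last by field; exact: lt0r_neq0.
rewrite (_ : c / d * (d ^+ 2 * D) = c * d * D); last by field; exact: lt0r_neq0.
lra.
Qed.

(** * The primal-dual product and its skew coupling *)

Section ProductSpace.
Context {R : realType} {H : hilbertType R} {I : finType} {G : I -> hilbertType R}.

Definition prim_dual (o : option I) : hilbertType R :=
  if o is Some i then G i else H.

Definition pair_fam (a : H) (b : forall i, G i) (o : option I) : prim_dual o :=
  if o is Some i then b i else a.

Context (L : forall i, {linear H -> G i}) (cL : forall i, continuous (L i)).
Implicit Types X Y : forall o, prim_dual o.

Definition skew_op X : forall o, prim_dual o :=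
  pair_fam (\sum_i adjoint (L i) (X (Some i))) (fun i => - L i (X None)).

Lemma skew_opB X Y o : skew_op X o - skew_op Y o = skew_op (fun o => X o - Y o) o.
Proof.
case: o => [i|] /=; first by rewrite linearB opprB opprK addrC.
by rewrite -sumrB; apply: eq_bigr => i _; rewrite adjointB.
Qed.

Lemma sum_skew_op X : \sum_o '<[X o, skew_op X o]> = 0.
Proof.
rewrite big_option /= ipC ip_suml -big_split big1 //= => i _.
by rewrite ipNr ipC (adjointP (@cL i)) ipC subrr.
Qed.

(** The dual blocks are bounded directly by the operator norms, the primal block [w] by pairing it
    with itself. This is the square-root term of [beta]. *)
Lemma sqn_skew_op X : 0 < \sum_i opnorm (L i) ^+ 2 ->
  sqn (skew_op X) <= (\sum_i opnorm (L i) ^+ 2) * sqn X.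
Proof.
set S := \sum_i _ => S0.
rewrite /sqn !big_option /= mulrDr addrC lerD //.
  rewrite mulr_suml; apply: ler_sum => i _.
  rewrite ipNl ipNr opprK !inner_norm -exprMn ler_pXn2r ?nnegrE //.
    exact: le_opnorm.
  by rewrite (le_trans _ (le_opnorm (@cL i) _)).
set w := \sum_i adjoint (L i) _.
have ww : '<[w, w]> = \sum_i '<[L i w, X (Some i)]>.
  by rewrite {1}/w ip_suml; apply: eq_bigr => i _; rewrite ipC -(adjointP (@cL i)).
suff : 2 * '<[w, w]> <= '<[w, w]> + S * \sum_i '<[X (Some i), X (Some i)]> by lra.
(* Splitting [|w| ^+ 2] into shares proportional to [opnorm (L i) ^+ 2] makes the inequality hold
   term by term. *)
rewrite {1}ww; have -> : '<[w, w]> = \sum_i opnorm (L i) ^+ 2 / S * '<[w, w]>.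
  by rewrite -mulr_suml -mulr_suml mulfV ?mul1r // lt0r_neq0.
rewrite !mulr_sumr -big_split /=; apply: ler_sum => i _.
have h1 := le_trans (ler_norm _) (cauchy_schwarz (L i w) (X (Some i))).
have h2 := ler_wpM2r (normr_ge0 (X (Some i))) (le_opnorm (@cL i) w).
apply: (@le_trans _ _ (2 * (opnorm (L i) * `|w| * `|X (Some i)|))).
  by rewrite ler_wpM2l // (le_trans h1).
rewrite !inner_norm -(ler_pM2l S0) mulrDr.
have := sqr_ge0 (opnorm (L i) * `|w| - S * `|X (Some i)|).
rewrite (_ : S * (opnorm (L i) ^+ 2 / S * `|w| ^+ 2) = opnorm (L i) ^+ 2 * `|w| ^+ 2).
  lra.
by field; exact: lt0r_neq0.
Qed.

End ProductSpace.

(** The blocks of [M] translate the values of [A] and [inv_op (B i)] by [- z] and [r i]; a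
    translation cancels in differences of values. *)
Lemma uniformly_monotone_shift (R : realType) (H : hilbertType R)
    (S T : H -> set H) (c x : H) : (forall y u, S y u <-> T y (u + c)) ->
  uniformly_monotone_at T x -> uniformly_monotone_at S x.
Proof.
move=> ST [[u Tu] [phi [phi0 phi_nd phi_eq0 phiP]]]; split.
  by exists (u - c); apply/ST; rewrite subrK.
exists phi; split=> // u' y w /ST Tx /ST Ty.
by have := phiP _ y (w + c) Tx Ty; rewrite opprD addrACA subrr addr0.
Qed.

(** Squares the step-size bound and clears its denominators, giving the polynomial form used for the
    iteration. *)
Lemma le_step_bound (R : rcfType) (l b N D : R) : 0 <= l -> 0 < b -> 0 <= N -> 0 < D ->
  l <= b^-1 * Num.sqrt (N / D) -> (l * b) ^+ 2 * D <= N.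
Proof.
move=> l0 b0 N0 D0; rewrite mulrC ler_pdivlMr // => h.
rewrite -ler_pdivlMr // -[X in _ <= X]sqr_sqrtr; last by rewrite divr_ge0 // ltW.
by rewrite ler_pXn2r ?nnegrE ?sqrtr_ge0 // mulr_ge0 // ltW.
Qed.

(** * Reduction of the primal-dual system to the product-space iteration *)

Theorem theorem9 (R : realType) (H : hilbertType R) (z : H)
  (A : H -> set H) (hA : maximally_monotone A)
  (C : H -> H) (mu : R) (hmu : 0 < mu)
  (hCmono : monotone_op (fun_op C)) (hClip : mu.-lipschitz C)
  (m : nat) (hm : (0 < m)%N)
  (G : 'I_m -> hilbertType R) (r : forall i, G i)
  (B : forall i, G i -> set (G i)) (hB : forall i, maximally_monotone (B i))
  (D : forall i, G i -> set (G i)) (hDmono : forall i, monotone_op (D i))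
  (nu : 'I_m -> R) (hnu : forall i, 0 < nu i)
  (hDsv : forall i, single_valued (inv_op (D i)))
  (hDlip : forall i, (nu i).-lipschitz (op_fun (inv_op (D i))))
  (L : forall i, {linear H -> G i}) (hLcont : forall i, continuous (L i))
  (hLneq0 : forall i, exists x : H, L i x != 0)
  (hz : ran
    (add_op
      (add_op A
        (sum_op (fun i x =>
          adjoint (L i) @` psum_op (B i) (D i) (L i x - r i))))
      (fun_op C)) z)
  (beta : R)
  (hbeta : beta = \big[Num.max/mu]_(i < m) nu i
                  + Num.sqrt (\sum_(i < m) opnorm (L i) ^+ 2))
  (lambda sigma : R) (hlambda : 0 < lambda) (hsigma : 0 < sigma)
  (alpha1 alpha2 : R) (halpha1 : 0 <= alpha1) (halpha2 : 0 <= alpha2)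
  (hpar : 12 * alpha2 ^+ 2 + 9 * (alpha1 + alpha2) + 4 * sigma < 1)
  (lam : nat -> R)
  (hlam : forall n, (1 <= n)%N ->
    lambda <= lam n /\
    lam n <= beta^-1 *
      Num.sqrt ((1 - 12 * alpha2 ^+ 2 - 9 * (alpha1 + alpha2) - 4 * sigma)
                / (12 * alpha2 ^+ 2 + 8 * (alpha1 + alpha2) + 4 * sigma + 2)))
  (a1 a2 : nat -> R)
  (ha1_nd : forall k n, (1 <= k)%N -> (k <= n)%N -> a1 k <= a1 n)
  (ha2_nd : forall k n, (1 <= k)%N -> (k <= n)%N -> a2 k <= a2 n)
  (ha1_1 : a1 1%N = 0) (ha2_1 : a2 1%N = 0)
  (ha1 : forall n, (1 <= n)%N -> 0 <= a1 n /\ a1 n <= alpha1)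
  (ha2 : forall n, (1 <= n)%N -> 0 <= a2 n /\ a2 n <= alpha2)
  (x p1 : nat -> H) (v p2 : forall i, nat -> G i)
  (hp1 : forall n, (1 <= n)%N ->
    p1 n = op_fun (resolvent (scale_op (lam n) A))
      (x n - lam n *: (C (x n) + \sum_(i < m) adjoint (L i) (v i n) - z)
       + a1 n *: (x n - x n.-1)))
  (hp2 : forall i n, (1 <= n)%N ->
    p2 i n = op_fun (resolvent (scale_op (lam n) (inv_op (B i))))
      (v i n + lam n *: (L i (x n) - op_fun (inv_op (D i)) (v i n) - r i)
       + a1 n *: (v i n - v i n.-1)))
  (hv : forall i n, (1 <= n)%N ->
    v i n.+1 = lam n *: L i (p1 n - x n)
      + lam n *: (op_fun (inv_op (D i)) (v i n)
                  - op_fun (inv_op (D i)) (p2 i n))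
      + p2 i n + a2 n *: (v i n - v i n.-1))
  (hx : forall n, (1 <= n)%N ->
    x n.+1 = lam n *: (\sum_(i < m) adjoint (L i) (v i n - p2 i n))
      + lam n *: (C (x n) - C (p1 n))
      + p1 n + a2 n *: (x n - x n.-1)) :
  ([/\ (\sum_(0 <= n <oo) (`|x n.+1 - x n| ^+ 2)%R%:E < +oo)%E,
       (\sum_(1 <= n <oo) (`|x n - p1 n| ^+ 2)%R%:E < +oo)%E,
       (forall i,
         (\sum_(0 <= n <oo) (`|v i n.+1 - v i n| ^+ 2)%R%:E < +oo)%E) &
       (forall i,
         (\sum_(1 <= n <oo) (`|v i n - p2 i n| ^+ 2)%R%:E < +oo)%E)])
  /\
  exists (xbar : H) (vbar : forall i, G i),
    [/\ add_op A (fun_op C) xbar (z - \sum_(i < m) adjoint (L i) (vbar i))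
        /\ (forall i,
             psum_op (B i) (D i) (L i xbar - r i) (vbar i)),
        [/\ weakly_cvg x xbar, weakly_cvg p1 xbar,
            (forall i, weakly_cvg (v i) (vbar i)) &
            (forall i, weakly_cvg (p2 i) (vbar i))],
        uniformly_monotone_at (add_op A (fun_op C)) xbar ->
          (x n @[n --> \oo] --> xbar) /\ (p1 n @[n --> \oo] --> xbar) &
        forall i,
          uniformly_monotone_at
            (add_op (inv_op (B i)) (inv_op (D i))) (vbar i) ->
          (v i n @[n --> \oo] --> vbar i) /\
          (p2 i n @[n --> \oo] --> vbar i)].
Proof.
set Dinv := fun i => op_fun (inv_op (D i)).
have DinvE i : inv_op (D i) = fun_op (Dinv i) by exact: single_valued_fun_op.
have Dinv_mono i : monotone_op (fun_op (Dinv i)).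
  by rewrite -DinvE; exact: monotone_inv.
have lip_sqr (K : hilbertType R) (c : R) (f : K -> K) (d : R) : c <= d -> 0 <= c ->
    c.-lipschitz f -> forall a b, '<[f a - f b, f a - f b]> <= d ^+ 2 * '<[a - b, a - b]>.
  move=> cd c0 fl a b; rewrite !inner_norm.
  apply: (@le_trans _ _ ((c * `|a - b|) ^+ 2)).
    by rewrite ler_pXn2r ?nnegrE ?mulr_ge0 //; exact: (fl (a, b)).
  by rewrite exprMn ler_wpM2r ?sqr_ge0 // ler_pXn2r ?nnegrE // (le_trans c0).
pose E := @prim_dual R H 'I_m G.
pose M : forall o, E o -> set (E o) := fun o =>
  match o with
  | None => fun y => [set u : H | A y (u + z)]
  | Some i => fun w => [set u : G i | B i (u - r i) w]
  end.
pose K : forall o, E o -> E o := fun o =>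
  match o with None => C | Some i => Dinv i end.
pose Q (X : forall o, E o) o : E o := K o (X o) + skew_op L X o.
pose c1 : R := \big[Num.max/mu]_(i < m) nu i.
pose S := \sum_(i < m) opnorm (L i) ^+ 2.
have mu_c1 : mu <= c1 by exact: bigmax_ge_id.
have c10 : 0 < c1 by exact: lt_le_trans mu_c1.
have S0 : 0 < S.
  pose i0 := Ordinal hm; have [y Ly] := hLneq0 i0.
  rewrite /S (bigD1 i0) //= ltr_pwDl ?sumr_ge0 // => [|i _]; last exact: sqr_ge0.
  rewrite exprn_even_gt0 //=; apply: contraNneq Ly => L0.
  by have := le_opnorm (hLcont i0) y; rewrite L0 mul0r normr_le0.
have beta0 : 0 < beta by rewrite hbeta addr_gt0 // sqrtr_gt0.
have K_lip o a b : '<[K o a - K o b, K o a - K o b]> <= c1 ^+ 2 * '<[a - b, a - b]>.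
  case: o a b => [i|] a b.
    exact: (lip_sqr _ (nu i) (Dinv i) c1 (le_bigmax _ _ _) (ltW (hnu i))).
  exact: (lip_sqr _ mu C c1 mu_c1 (ltW hmu)).
have K_mono o : monotone_op (fun_op (K o)) by case: o.
have M_mono o : monotone_op (M o).
  case: o => [i|] y u y' u'; rewrite /gr /M /= => h h'.
    have := monotone_inv (hB i).1 h h'.
    by rewrite opprD opprK addrACA [- r i + _]addrC subrr addr0.
  by have := hA.1 _ _ _ _ h h'; rewrite opprD addrACA subrr addr0.
have M_minty o t w : 0 < t -> exists q, M o q (t^-1 *: (w - q)).
  move=> t0; have tN0 := lt0r_neq0 t0; case: o w => [i|] w.
    (* Translating the values of an operator amounts to translating the argument of its
       resolvent. *)
    have [q qP] := minty_inv (minty (hB i)) (w - t *: r i) t0.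
    exists q => /=; rewrite /inv_op /= in qP.
    rewrite (_ : _ - r i = t^-1 *: (w - t *: r i - q)) //.
    by apply: ip_inj => y; rewrite !ipE; field.
  have [q qP] := minty hA (w + t *: z) t0.
  exists q => /=; rewrite (_ : _ + z = t^-1 *: (w + t *: z - q)) //.
  by apply: ip_inj => y; rewrite !ipE; field.
have skew0 X Y : \sum_o '<[X o - Y o, skew_op L X o - skew_op L Y o]> = 0.
  rewrite -[RHS](sum_skew_op hLcont (fun o => X o - Y o)).
  by apply: eq_bigr => o _; rewrite skew_opB.
have QB X Y o : Q X o - Q Y o =
    (K o (X o) - K o (Y o)) + skew_op L (fun o => X o - Y o) o.
  by rewrite -(skew_opB hLcont) /Q opprD addrACA.
have Q_mono X Y : 0 <= \sum_o '<[X o - Y o, Q X o - Q Y o]>.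
  under eq_bigr do rewrite QB ipDr.
  rewrite big_split /= (sum_skew_op hLcont (fun o => X o - Y o)) addr0.
  by apply: sumr_ge0 => o _; exact: (K_mono o (X o) (K o (X o)) (Y o) (K o (Y o))).
have Q_lip X Y : sqn (fun o => Q X o - Q Y o) <= beta ^+ 2 * sqn (fun o => X o - Y o).
  rewrite (_ : sqn _ = sqn (fun o => (K o (X o) - K o (Y o))
      + skew_op L (fun o => X o - Y o) o)); last first.
    by apply: eq_bigr => o _; rewrite QB.
  rewrite hbeta; apply: sqn_add_le => //.
  - by rewrite sqrtr_gt0.
  - by rewrite /sqn mulr_sumr; apply: ler_sum => o _; exact: K_lip.
  - rewrite sqr_sqrtr; last exact: ltW.
    exact: (sqn_skew_op hLcont (fun o => X o - Y o) S0).
have lam_ge n : lambda <= lam n.+1 by have [] := hlam n.+1 isT.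
have lam0 n : 0 < lam n.+1 by exact: lt_le_trans (lam_ge n).
have lamN0 n : lam n.+1 != 0 by exact: lt0r_neq0.
have par n : 12 * alpha2 ^+ 2 * (1 + (lam n.+1 * beta) ^+ 2)
    + 9 * (alpha1 + alpha2) + 8 * (alpha1 + alpha2) * (lam n.+1 * beta) ^+ 2
    + 4 * sigma * (1 + (lam n.+1 * beta) ^+ 2) + 2 * (lam n.+1 * beta) ^+ 2 <= 1.
  have s0 := sqr_ge0 alpha2; have al0 := addr_ge0 halpha1 halpha2.
  have := le_step_bound (ltW (lam0 n)) beta0 _ _ (hlam n.+1 isT).2.
  by move=> /(_ ltac:(lra) ltac:(lra)); lra.
pose X n : forall o, E o := pair_fam (x n) (fun i => v i n).
(* The recursion constrains [p1] and [p2] from index 1 on, whereas [X] starts at 0; hence the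
   shift. *)
pose P n : forall o, E o := pair_fam (p1 n.+1) (fun i => p2 i n.+1).
have PP n o : M o (P n o) ((lam n.+1)^-1 *: (X n.+1 o
    - lam n.+1 *: Q (X n.+1) o + a1 n.+1 *: (X n.+1 o - X n o) - P n o)).
  case: o => [i|] /=.
    have := op_fun_resolvent (lam0 n) (minty_inv (minty (hB i)) (v i n.+1
      + lam n.+1 *: (L i (x n.+1) - Dinv i (v i n.+1) - r i)
      + a1 n.+1 *: (v i n.+1 - v i n)) (lam0 n)).
    rewrite -hp2 // /inv_op /=; congr (B i _ _).
    by apply: ip_inj => y; rewrite /Q /= !ipE; field.
  have := op_fun_resolvent (lam0 n) (minty hA (x n.+1 - lam n.+1 *:
    (C (x n.+1) + \sum_(i < m) adjoint (L i) (v i n.+1) - z)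
      + a1 n.+1 *: (x n.+1 - x n)) (lam0 n)).
  rewrite -hp1 //; congr (A _ _).
  by apply: ip_inj => y; rewrite /Q /= !ipE; field.
have XP n o : X n.+2 o = lam n.+1 *: (Q (X n.+1) o - Q (P n) o) + P n o
    + a2 n.+1 *: (X n.+1 o - X n o).
  rewrite QB; case: o => [i|] /=.
    by rewrite hv // !linearB /=; apply: ip_inj => y; rewrite !ipE; ring.
  by rewrite hx //; apply: ip_inj => y; rewrite !ipE; ring.
pose zero (w : forall o, E o) := forall o, M o (w o) (- Q w o).
have psumE i y w : psum_op (B i) (D i) y w <-> B i (y - Dinv i w) w.
  by rewrite /psum_op DinvE; exact: add_op_fun.
(* Zeros of [M + Q] are the primal-dual solutions: [psumE] moves the single-valued [Dinv i] to the
   other side of the inclusion. *)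
have zeroP (a : H) (b : forall i, G i) : zero (pair_fam a b) <->
    add_op A (fun_op C) a (z - \sum_(i < m) adjoint (L i) (b i)) /\
    (forall i, psum_op (B i) (D i) (L i a - r i) (b i)).
  have e0 : z - \sum_(i < m) adjoint (L i) (b i) - C a = - Q (pair_fam a b) None + z.
    by apply: ip_inj => y; rewrite /Q /= !ipE; ring.
  have e1 i : L i a - r i - Dinv i (b i) = - Q (pair_fam a b) (Some i) - r i.
    by apply: ip_inj => y; rewrite /Q /= !ipE; ring.
  split=> [zab|[/add_op_fun Aa Bb]].
    split=> [|i]; first by apply/add_op_fun; rewrite e0; exact: (zab None).
    by apply/psumE; rewrite e1; exact: (zab (Some i)).
  case=> [i|]; first by have /psumE := Bb i; rewrite e1.
  by move: Aa; rewrite e0.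
(* The range condition gives a primal point and, for each [i], an image under [adjoint (L i)];
   preimages of these images are the dual components. *)
have [z0 z0P] : exists z0, zero z0.
  have [a _ [_ [u Aau [_ [s sP <-] <-]] [_ -> zE]]] := hz.
  have : forall i, {b | psum_op (B i) (D i) (L i a - r i) b & adjoint (L i) b = s i}.
    by move=> i; apply: cid2; have [b hb hs] := sP i; exists b.
  move=> /all_sig2[b bP bs]; exists (pair_fam a b); apply/zeroP; split=> //.
  have bsE : \sum_(i < m) adjoint (L i) (b i) = \sum_(i < m) s i by exact: eq_bigr.
  apply/add_op_fun; rewrite -zE bsE.
  by rewrite (_ : _ - _ - _ = u) //; apply: ip_inj => y; rewrite !ipE; ring.
have a1_nd n : a1 n.+1 <= a1 n.+2 by exact: ha1_nd.
have a2_nd n : a2 n.+1 <= a2 n.+2 by exact: ha2_nd.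
have a1_ge0 n : 0 <= a1 n.+1 by have [] := ha1 n.+1 isT.
have a2_ge0 n : 0 <= a2 n.+1 by have [] := ha2 n.+1 isT.
have a1_le n : a1 n.+1 <= alpha1 by have [] := ha1 n.+1 isT.
have a2_le n : a2 n.+1 <= alpha2 by have [] := ha2 n.+1 isT.
have [[B1 hB1] [B2 hB2] gap0 [w [zw xw pw strong]]] := inertial_fbf M_mono
  M_minty Q_mono Q_lip beta0 hlambda hsigma lam_ge par a1_nd a2_nd ha1_1 ha2_1
  a1_ge0 a2_ge0 a1_le a2_le PP XP z0P.
split.
  have le1 o n : \sum_(0 <= k < n) `|X k.+1 o - X k o| ^+ 2 <= B1.
    apply: le_trans (hB1 n); apply: ler_sum => k _; rewrite -inner_norm.
    exact: (ip_le_sqn (fun o => X k.+1 o - X k o)).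
  have le2 o n : \sum_(0 <= k < n) `|X k.+1 o - P k o| ^+ 2 <= B2.
    apply: le_trans (hB2 n); apply: ler_sum => k _; rewrite -inner_norm.
    exact: (ip_le_sqn (fun o => X k.+1 o - P k o)).
  split=> [||i|i].
  - apply: (@nneseries_lty _ _ _ B1) => [n|n]; first exact: sqr_ge0.
    exact: (le1 None).
  - apply: (@nneseries_lty _ _ _ B2) => [n|n]; first exact: sqr_ge0.
    by rewrite big_add1; exact: (le2 None).
  - apply: (@nneseries_lty _ _ _ B1) => [n|n]; first exact: sqr_ge0.
    exact: (le1 (Some i)).
  - apply: (@nneseries_lty _ _ _ B2) => [n|n]; first exact: sqr_ge0.
    by rewrite big_add1; exact: (le2 (Some i)).
have wE : zero (pair_fam (w None) (fun i => w (Some i))).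
  rewrite (_ : pair_fam _ _ = w) //.
  by apply: functional_extensionality_dep => -[i|].
have [sol0 sol1] := (zeroP _ _).1 wE.
(* Strong convergence of [P] passes to [X] because the gap tends to zero. *)
have both o : uniformly_monotone_at (add_op (M o) (fun_op (K o))) (w o) ->
    X n o @[n --> \oo] --> w o /\ P n o @[n --> \oo] --> w o.
  move=> um; have pc := strong K (skew_op L) o (fun _ _ => erefl) K_mono skew0 um.
  split=> //; rewrite -(cvg_shiftS (fun n => X n o)) /=.
  rewrite (_ : (fun n => _) = fun n => (X n.+1 o - P n o) + P n o).
    by rewrite -[w o]add0r; apply: cvgD => //; exact: gap0.
  by apply/funext => n; rewrite subrK.
exists (w None), (fun i => w (Some i)); split.
- by [].
- split.
  + exact: (xw None).
  + by move=> y; rewrite -(cvg_shiftS (fun n => '<[p1 n, y]>)); exact: (pw None).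
  + by move=> i; exact: (xw (Some i)).
  + by move=> i y; rewrite -(cvg_shiftS (fun n => '<[p2 i n, y]>)); exact: (pw (Some i)).
- move=> um; have [|xc pc] := both None.
    apply: uniformly_monotone_shift um => y u.
    by split=> /add_op_fun h; apply/add_op_fun; move: h; rewrite /M /= addrAC; apply.
  by split=> //; rewrite -(cvg_shiftS p1).
- move=> i um; have [|vc pc] := both (Some i).
    apply: uniformly_monotone_shift um => y u.
    rewrite DinvE.
    by split=> /add_op_fun h; apply/add_op_fun; move: h; rewrite /M /inv_op /= addrAC; apply.
  by split=> //; rewrite -(cvg_shiftS (p2 i)).
Qed.
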